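(* Let $G$ be a bipartite graph without isolated vertices. Then $S/I(G)^{(2)}$ is generalized Cohen-Macaulay if and only if $G$ is a complete bipartite graph $K_{m,m}$ for some $m\ge 2$, or a path of length 3, or a disjoint union of edges.
   Context: $k$ is a fixed field. Graphs are finite and simple (no loops, no multiple edges), $V(G)=[n]=\{1,\dots,n\}$ with $n\ge 1$, $S=k[x_1,\dots,x_n]$, $\mathfrak m=(x_1,\dots,x_n)S$. The edge ideal is $I(G)=(x_ix_j : ij\in E(G))\subseteq S$. $I(G)^{(2)}=\bigcap_F P_F^2$, where $F$ runs over the maximal independent sets of $G$ and $P_F=(x_j : j\notin F)S$. For $I$ a monomial ideal, $S/I$ is generalized Cohen-Macaulay if $H^i_{\mathfrak m}(S/I)$ has finite length for all $i<\dim(S/I)$. $G$ is bipartite if its vertex set can be partitioned into two subsets $X,Y$ such that every edge has one vertex in $X$ and one in $Y$; $K_{m,m}$ is the complete bipartite graph with both parts of size $m$. A path of length 3 is a path with 3 edges (and 4 vertices). $G$ is a disjoint union of edges if every vertex has degree exactly $1$. *)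

(* Defs.v *)
From HB Require Import structures.
From mathcomp Require Import all_boot all_order all_algebra.
From mathcomp Require Import generic_quotient ring_quotient.
From mathcomp Require Import boolp.
From mathcomp Require Import mpoly.
From mathcomp Require Import ring zify.

Set Implicit Arguments.
Unset Strict Implicit.
Unset Printing Implicit Defensive.

Import GRing.Theory.
Local Open Scope ring_scope.
Local Open Scope quotient_scope.

Section Submodules.
Variables (R : comNzRingType) (M : lmodType R) (N : submodClosed M).

Record submod := Submod {submod_val : M; _ : submod_val \in N}.

HB.instance Definition _ := [isSub for submod_val].
HB.instance Definition _ := [Choice of submod by <:].

(* [submodClosed] does not record closure under opposites, which the library
   quotient of a zmodType requires. *)
Definition submod_pred : {pred M} := N.

Lemma submod_pred_closed : zmod_closed submod_pred.
Proof.
split; first exact: (rpred0 N).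
by move=> x y xN yN; rewrite -scaleN1r; apply: rpredD => //; apply: rpredZ.
Qed.

HB.instance Definition _ := GRing.isZmodClosed.Build M submod_pred
  submod_pred_closed.

Lemma submod_pred_scaler : scaler_closed submod_pred.
Proof. by move=> a x xN; apply: rpredZ. Qed.

Lemma submod_is_submod : submod_closed (fun x : M => x \in N).
Proof.
split; first exact: (rpred0 N).
by move=> a x y xN yN; apply: rpredD => //; apply: rpredZ.
Qed.

HB.instance Definition _ :=
  GRing.SubChoice_isSubLmodule.Build R M (fun x => x \in N) submod
    submod_is_submod.

Definition quotmod := Quotient.quot submod_pred.

HB.instance Definition _ := ZmodQuotient.on quotmod.

Definition quotmod_scale (a : R) (u : quotmod) : quotmod :=
  \pi_quotmod (a *: repr u).

Lemma pi_quotmod_scale a (x : M) :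
  quotmod_scale a (\pi_quotmod x) = \pi_quotmod (a *: x).
Proof.
apply/eqP; rewrite /quotmod_scale -Quotient.idealrBE -scalerBr.
apply: submod_pred_scaler; rewrite Quotient.idealrBE.
exact/eqP/reprK.
Qed.

Lemma quotmod_ind (P : quotmod -> Prop) :
  (forall x, P (\pi_quotmod x)) -> forall u, P u.
Proof. by move=> h u; rewrite -[u]reprK. Qed.

Lemma pi_quotmodD x y :
  \pi_quotmod (x + y) = \pi_quotmod x + \pi_quotmod y.
Proof. exact: (@Quotient.pi_add _ submod_pred). Qed.

Lemma quotmod_scaleA a b u :
  quotmod_scale a (quotmod_scale b u) = quotmod_scale (a * b) u.
Proof. by elim/quotmod_ind: u => x; rewrite !pi_quotmod_scale scalerA. Qed.

Lemma quotmod_scale1 : left_id 1 quotmod_scale.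
Proof. by elim/quotmod_ind => x; rewrite pi_quotmod_scale scale1r. Qed.

Lemma quotmod_scaleDr : right_distributive quotmod_scale +%R.
Proof.
move=> a; elim/quotmod_ind=> x; elim/quotmod_ind=> y.
by rewrite -pi_quotmodD !pi_quotmod_scale -pi_quotmodD scalerDr.
Qed.

Lemma quotmod_scaleDl u : {morph quotmod_scale^~ u : a b / a + b}.
Proof.
by elim/quotmod_ind: u => x a b; rewrite !pi_quotmod_scale -pi_quotmodD scalerDl.
Qed.

HB.instance Definition _ := GRing.Zmodule_isLmodule.Build R quotmod
  quotmod_scaleA quotmod_scale1 quotmod_scaleDr quotmod_scaleDl.

End Submodules.

(* Ideals of R are the submodules of the regular module R^o. *)
Section Ideals.
Variable R : comNzRingType.

Definition ideal_gen (A : R -> Prop) : {pred R^o} := fun x =>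
  `[< forall J : submodClosed R^o, (forall a, A a -> a \in J) -> x \in J >].

Lemma ideal_gen_submod A : submod_closed (ideal_gen A).
Proof.
split; first by apply/asboolP => J _; apply: rpred0.
move=> a x y /asboolP hx /asboolP hy; apply/asboolP => J AJ.
by apply: rpredD; [apply: rpredZ; apply: hx | apply: hy].
Qed.

HB.instance Definition _ A := GRing.isSubmodClosed.Build R R^o (ideal_gen A)
  (ideal_gen_submod A).

Definition ideal_mul (I J : submodClosed R^o) : submodClosed R^o :=
  ideal_gen (fun z => exists x y : R, [/\ x \in I, y \in J & z = x * y]).

Definition ideal_bigcap (T : Type) (D : T -> Prop) (I : T -> submodClosed R^o) :
  {pred R^o} := fun x => `[< forall t, D t -> x \in I t >].

Lemma ideal_bigcap_submod T D I : submod_closed (@ideal_bigcap T D I).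
Proof.
split; first by apply/asboolP => t _; apply: rpred0.
move=> a x y /asboolP hx /asboolP hy; apply/asboolP => t Dt.
by apply: rpredD; [apply: rpredZ; apply: hx | apply: hy].
Qed.

HB.instance Definition _ T D I := GRing.isSubmodClosed.Build R R^o
  (@ideal_bigcap T D I) (ideal_bigcap_submod D I).

End Ideals.

(* The localization M_f: the pair (m, t) stands for m / f^t. *)
Section Localization.
Variables (R : comNzRingType) (M : lmodType R) (f : R).
Implicit Types (p q : M * nat).

Definition loc_equiv p q : bool :=
  `[< exists c, f ^+ (c + q.2) *: p.1 = f ^+ (c + p.2) *: q.1 >].

Lemma loc_equiv_refl : reflexive loc_equiv.
Proof. by move=> p; apply/asboolP; exists 0. Qed.

Lemma loc_equiv_sym : ssrbool.symmetric loc_equiv.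
Proof. by move=> p q; apply/asboolP/asboolP => -[c h]; exists c. Qed.

Lemma loc_equiv_trans : transitive loc_equiv.
Proof.
move=> [q b] [p a] [r d] /asboolP[/= c h] /asboolP[/= c' h'].
apply/asboolP; exists (c + c' + b)%N => /=.
have -> : (c + c' + b + d = (c' + d) + (c + b))%N by lia.
have -> : (c + c' + b + a = (c + a) + (c' + b))%N by lia.
by rewrite (exprD _ (c' + d)) (exprD _ (c + a)) -!scalerA h -h' !scalerA mulrC.
Qed.

Canonical loc_equiv_rel :=
  EquivRel loc_equiv loc_equiv_refl loc_equiv_sym loc_equiv_trans.

Definition loc := {eq_quot loc_equiv_rel}.

HB.instance Definition _ := Choice.on loc.
HB.instance Definition _ : EqQuotient (M * nat)%type loc_equiv_rel loc :=
  EqQuotient.on loc.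

Definition loc_frac (m : M) (t : nat) : loc := \pi_loc (m, t).

Lemma loc_fracP m t m' t' :
  (exists c, f ^+ (c + t') *: m = f ^+ (c + t) *: m') <->
  loc_frac m t = loc_frac m' t'.
Proof.
split=> [h|/eqP]; first by apply/eqP; rewrite eqmodE; apply/asboolP.
by rewrite eqmodE => /asboolP.
Qed.

Lemma loc_ind (P : loc -> Prop) : (forall m t, P (loc_frac m t)) -> forall u, P u.
Proof. by move=> h u; rewrite -[u]reprK; case: (repr u) => m t; apply: h. Qed.

Lemma loc_repr m t : exists m' t' c, [/\ repr (loc_frac m t) = (m', t') &
  f ^+ (c + t) *: m' = f ^+ (c + t') *: m].
Proof.
case E: (repr (loc_frac m t)) => [m' t'].
have : loc_frac m' t' = loc_frac m t by rewrite /loc_frac -E reprK.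
by move=> /loc_fracP[c h]; exists m', t', c.
Qed.

Definition loc_add (u v : loc) : loc :=
  let: (m, a) := repr u in let: (m', b) := repr v in
  loc_frac (f ^+ b *: m + f ^+ a *: m') (a + b).
Definition loc_opp (u : loc) : loc :=
  let: (m, a) := repr u in loc_frac (- m) a.
Definition loc_scale (r : R) (u : loc) : loc :=
  let: (m, a) := repr u in loc_frac (r *: m) a.

Lemma loc_addE m a m' b : loc_add (loc_frac m a) (loc_frac m' b) =
  loc_frac (f ^+ b *: m + f ^+ a *: m') (a + b).
Proof.
rewrite /loc_add; have [n [s [c [-> h]]]] := loc_repr m a.
have [n' [s' [c' [-> h']]]] := loc_repr m' b.
apply/loc_fracP; exists (c + c')%N; rewrite !scalerDr !scalerA -!exprD.
congr (_ + _).
- have -> : (c + c' + (a + b) + s' = (c' + b + s') + (c + a))%N by lia.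
  rewrite exprD -scalerA h scalerA -exprD; congr (f ^+ _ *: _); lia.
- have -> : (c + c' + (a + b) + s = (c + a + s) + (c' + b))%N by lia.
  rewrite exprD -scalerA h' scalerA -exprD; congr (f ^+ _ *: _); lia.
Qed.

Lemma loc_oppE m a : loc_opp (loc_frac m a) = loc_frac (- m) a.
Proof.
rewrite /loc_opp; have [n [s [c [-> h]]]] := loc_repr m a.
by apply/loc_fracP; exists c; rewrite !scalerN h.
Qed.

Lemma loc_scaleE r m a : loc_scale r (loc_frac m a) = loc_frac (r *: m) a.
Proof.
rewrite /loc_scale; have [n [s [c [-> h]]]] := loc_repr m a.
apply/loc_fracP; exists c.
by rewrite !scalerA ![_ * r]mulrC -!scalerA h.
Qed.

Lemma loc_addA : associative loc_add.
Proof.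
elim/loc_ind=> m a; elim/loc_ind=> m' b; elim/loc_ind=> m'' c.
rewrite !loc_addE addnA; congr loc_frac.
rewrite !scalerDr !scalerA -!exprD addrA [(a + c)%N]addnC.
by rewrite [(c + b)%N]addnC.
Qed.

Lemma loc_addC : commutative loc_add.
Proof.
by elim/loc_ind=> m a; elim/loc_ind=> m' b; rewrite !loc_addE addrC addnC.
Qed.

Lemma loc_add0 : left_id (loc_frac 0 0) loc_add.
Proof.
by elim/loc_ind=> m a; rewrite !loc_addE scaler0 add0r scale1r add0n.
Qed.

Lemma loc_addN : left_inverse (loc_frac 0 0) loc_opp loc_add.
Proof.
elim/loc_ind=> m a; rewrite loc_oppE loc_addE scalerN addNr.
by apply/loc_fracP; exists 0; rewrite !scaler0.
Qed.

HB.instance Definition _ := GRing.isZmodule.Build loc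
  loc_addA loc_addC loc_add0 loc_addN.

Lemma loc_scaleA a b u : loc_scale a (loc_scale b u) = loc_scale (a * b) u.
Proof. by elim/loc_ind: u => m t; rewrite !loc_scaleE scalerA. Qed.

Lemma loc_scale1 : left_id 1 loc_scale.
Proof. by elim/loc_ind=> m t; rewrite loc_scaleE scale1r. Qed.

Lemma loc_scaleDr : right_distributive loc_scale +%R.
Proof.
move=> r; elim/loc_ind=> m a; elim/loc_ind=> m' b.
rewrite /GRing.add /= loc_addE !loc_scaleE loc_addE; congr loc_frac.
by rewrite scalerDr !scalerA ![r * _]mulrC.
Qed.

Lemma loc_scaleDl u : {morph loc_scale^~ u : a b / a + b}.
Proof.
elim/loc_ind: u => m t a b; rewrite [RHS]/GRing.add /= !loc_scaleE loc_addE.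
apply/loc_fracP; exists 0.
by rewrite !add0n -scalerDr -scalerDl !scalerA -exprD.
Qed.

HB.instance Definition _ := GRing.Zmodule_isLmodule.Build R loc
  loc_scaleA loc_scale1 loc_scaleDr loc_scaleDl.

End Localization.

Arguments loc_frac {R M} f m t.

(* When h = f * g this is the canonical map M_f -> M_h,
   m / f^t |-> g^t m / h^t; for other h it is meaningless. *)
Definition loc_map (R : comNzRingType) (M : lmodType R) (f h g : R)
    (u : loc M f) : loc M h :=
  let: (m, t) := repr u in loc_frac h (g ^+ t *: m) t.
Arguments loc_map {R M f} h g u.

Section LocMap.
Variables (R : comNzRingType) (M : lmodType R) (f h g : R).
Hypothesis hE : h = f * g.

Lemma loc_mapE (m : M) t :
  loc_map h g (loc_frac f m t) = loc_frac h (g ^+ t *: m) t.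
Proof.
rewrite /loc_map; have [n [s [c [-> e]]]] := loc_repr f m t.
apply/loc_fracP; exists c; rewrite hE !exprMn !scalerA.
by rewrite -!mulrA -!exprD ![_ * g ^+ _]mulrC -!scalerA e addnAC.
Qed.

Lemma loc_map_linear : linear (loc_map h g : loc M f -> loc M h).
Proof.
move=> r; elim/loc_ind=> m a; elim/loc_ind=> m' b.
rewrite /GRing.scale /= !loc_scaleE [in LHS]/GRing.add /= loc_addE !loc_mapE.
rewrite loc_scaleE [RHS]/GRing.add /= loc_addE; congr loc_frac.
rewrite hE !exprMn scalerDr !scalerA !exprD.
by congr (_ *: _ + _ *: _); ring.
Qed.

End LocMap.

Section DirectProduct.
Variables (R : comNzRingType) (I : finType) (V : I -> lmodType R).

Definition dirprod := {dffun forall i, V i}.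

HB.instance Definition _ := Choice.on dirprod.

Implicit Types u v w : dirprod.
Definition dirprod_mk (g : forall i, V i) : dirprod := finfun g.
Definition dirprod0 := dirprod_mk (fun i => 0).
Definition dirprod_opp u := dirprod_mk (fun i => - u i).
Definition dirprod_add u v := dirprod_mk (fun i => u i + v i).
Definition dirprod_scale (a : R) u := dirprod_mk (fun i => a *: u i).

Lemma dirprod_addA : associative dirprod_add.
Proof. by move=> u v w; apply/ffunP => i; rewrite !ffunE addrA. Qed.
Lemma dirprod_addC : commutative dirprod_add.
Proof. by move=> u v; apply/ffunP => i; rewrite !ffunE addrC. Qed.
Lemma dirprod_add0 : left_id dirprod0 dirprod_add.
Proof. by move=> u; apply/ffunP => i; rewrite !ffunE add0r. Qed.
Lemma dirprod_addN : left_inverse dirprod0 dirprod_opp dirprod_add.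
Proof. by move=> u; apply/ffunP => i; rewrite !ffunE addNr. Qed.

HB.instance Definition _ := GRing.isZmodule.Build dirprod
  dirprod_addA dirprod_addC dirprod_add0 dirprod_addN.

Lemma dirprod_scaleA a b u :
  dirprod_scale a (dirprod_scale b u) = dirprod_scale (a * b) u.
Proof. by apply/ffunP => i; rewrite !ffunE scalerA. Qed.
Lemma dirprod_scale1 : left_id 1 dirprod_scale.
Proof. by move=> u; apply/ffunP => i; rewrite !ffunE scale1r. Qed.
Lemma dirprod_scaleDr : right_distributive dirprod_scale +%R.
Proof. by move=> a u v; apply/ffunP => i; rewrite !ffunE scalerDr. Qed.
Lemma dirprod_scaleDl u : {morph dirprod_scale^~ u : a b / a + b}.
Proof. by move=> a b; apply/ffunP => i; rewrite !ffunE scalerDl. Qed.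

HB.instance Definition _ := GRing.Zmodule_isLmodule.Build R dirprod
  dirprod_scaleA dirprod_scale1 dirprod_scaleDr dirprod_scaleDl.

End DirectProduct.

(* The local cohomology of M with support in the ideal (x_0, ..., x_(n-1)), as
   the cohomology of the Cech complex
     0 -> M -> prod_i M_(x_i) -> ... -> M_(x_0 ... x_(n-1)) -> 0. *)
Section LocalCohomology.
Variables (R : comNzRingType) (n : nat) (x : 'I_n -> R) (M : lmodType R).

Definition subset_of_card (p : nat) := {F : {set 'I_n} | #|F| == p}.

Definition cech (p : nat) :=
  dirprod (fun F : subset_of_card p => loc M (\prod_(i in val F) x i)).

HB.instance Definition _ p := GRing.Lmodule.on (cech p).

Definition cech_diff p (u : cech p) : cech p.+1 :=
  dirprod_mk (fun F : subset_of_card p.+1 =>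
    \sum_(G : subset_of_card p)
      \sum_(i : 'I_n | (i \notin val G) && (val F == i |: val G))
        (-1) ^+ #|[set j in val F | (j < i)%N]| *:
          loc_map (\prod_(j in val F) x j) (x i) (u G)).

Lemma cech_diff_linear p : linear (@cech_diff p).
Proof.
move=> a u v; apply/ffunP => F; rewrite !ffunE.
rewrite scaler_sumr -big_split; apply: eq_bigr => G _ /=.
rewrite scaler_sumr -big_split; apply: eq_bigr => i /andP[iG /eqP FE] /=.
rewrite !ffunE loc_map_linear; last by rewrite FE big_setU1 //= mulrC.
by rewrite scalerDr !scalerA mulrC.
Qed.

Lemma cech_diff0 p : @cech_diff p 0 = 0.
Proof.
have := cech_diff_linear (-1) (0 : cech p) 0.
by rewrite !scaleN1r oppr0 addr0 addNr.
Qed.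

Definition cocycle p : {pred cech p} := fun u => cech_diff u == 0.

Lemma cocycle_submod p : submod_closed (@cocycle p).
Proof.
split; first by apply/eqP; exact: cech_diff0.
move=> a u v /eqP hu /eqP hv; apply/eqP.
by rewrite cech_diff_linear hu hv scaler0 addr0.
Qed.

HB.instance Definition _ p := GRing.isSubmodClosed.Build R (cech p)
  (@cocycle p) (@cocycle_submod p).

Definition coboundary p : cech p -> Prop :=
  match p return cech p -> Prop with
  | 0 => fun u => u = 0
  | q.+1 => fun u => exists v : cech q, u = cech_diff v
  end.

Definition coboundary_pred p : {pred submod (@cocycle p)} :=
  fun z => `[< coboundary (val z) >].

Lemma coboundary_submod p : submod_closed (@coboundary_pred p).
Proof.
case: p => [|p]; split.
- by apply/asboolP; rewrite /coboundary raddf0.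
- move=> a z w /asboolP hz /asboolP hw; apply/asboolP.
  by move: hz hw; rewrite /coboundary linearP /= => -> ->; rewrite scaler0 addr0.
- by apply/asboolP; exists 0; rewrite raddf0 cech_diff0.
- move=> a z w /asboolP[u hz] /asboolP[v hw]; apply/asboolP.
  by exists (a *: u + v); rewrite linearP /= hz hw cech_diff_linear.
Qed.

HB.instance Definition _ p := GRing.isSubmodClosed.Build R
  (submod (@cocycle p)) (@coboundary_pred p) (@coboundary_submod p).

Definition local_cohomology (p : nat) : lmodType R :=
  quotmod (@coboundary_pred p).

End LocalCohomology.

Section LengthAndDimension.
Variables (R : comNzRingType).

Definition strict_sub (T : Type) (A B : {pred T}) : Prop :=
  {subset A <= B} /\ ~ {subset B <= A}.

Definition finite_length (M : lmodType R) : Prop :=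
  exists l : nat, forall (c : nat) (N : nat -> submodClosed M),
    (forall j, (j < c)%N -> strict_sub (N j) (N j.+1)) -> (c <= l)%N.

(* i < dim M, where dim M = dim (R / Ann M): there is a chain
   P_0 < ... < P_(i+1) of primes containing the annihilator of M. *)
Definition lt_dim (i : nat) (M : lmodType R) : Prop :=
  exists P : nat -> prime_idealr R,
    (forall r : R, (forall m : M, r *: m = 0) -> r \in P 0) /\
    (forall j, (j <= i)%N -> strict_sub (P j) (P j.+1)).

Definition generalized_CM (n : nat) (x : 'I_n -> R) (M : lmodType R) : Prop :=
  forall i : nat, lt_dim i M -> finite_length (local_cohomology x M i).

End LengthAndDimension.

Section Graphs.
Variables (n : nat) (e : rel 'I_n).

Definition bipartite : Prop :=
  exists X Y : {set 'I_n}, [/\ X :|: Y = setT, [disjoint X & Y] &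
    forall i j, e i j -> (i \in X) && (j \in Y) || (i \in Y) && (j \in X)].

Definition degree (i : 'I_n) : nat := #|[set j | e i j]|.

Definition independent (F : {set 'I_n}) : bool :=
  [forall i in F, forall j in F, ~~ e i j].

Definition graph_iso (T : Type) (e' : rel T) : Prop :=
  exists f : 'I_n -> T, bijective f /\ forall i j, e' (f i) (f j) = e i j.

End Graphs.

Definition complete_bipartite (a b : nat) : rel ('I_a + 'I_b) := fun u v =>
  match u, v with
  | inl _, inr _ | inr _, inl _ => true
  | _, _ => false
  end.

(* The path with l edges. *)
Definition path_graph (l : nat) : rel 'I_l.+1 := fun i j =>
  (i.+1 == j :> nat) || (j.+1 == i :> nat).

Section SymbolicSquare.
Variables (k : fieldType) (n : nat) (e : rel 'I_n).

Definition prime_of (F : {set 'I_n}) : submodClosed {mpoly k[n]}^o :=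
  ideal_gen (fun p : {mpoly k[n]} => exists2 j, j \notin F & p = 'X_j).

Definition symbolic_square : submodClosed {mpoly k[n]}^o :=
  ideal_bigcap (fun F : {set 'I_n} => maxset (independent e) F)
    (fun F => ideal_mul (prime_of F) (prime_of F)).

End SymbolicSquare.

(* Main.v *)
(* By Z^n-grading, the Cech complex of S/I^(2) splits into strands indexed by
   a in Z^n.  The strand of a is the cochain complex of the sets F that contain
   the negative support of a and lie in a maximal independent set F' whose
   complement has a-weight at most 1 ([live a F]).  A strand with some a_i >= 2
   and no negative entry is a cone with apex i, and making negative entries more
   negative does not change a strand.  So S/I^(2) is generalized Cohen-Macaulay
   iff the strands with a negative entry are acyclic below dim S/I^(2), which is
   the largest size of an independent set.
   Necessity: a maximal independent set F that is too small gives a class in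
   degree |F|; an edge uv and a nonempty set T, maximal among the independent
   sets of vertices not adjacent to u or v, give a disconnected strand (take
   a_u = a_v = 1 and a < 0 on T), hence a class in degree |T| + 1 unless |T| + 1
   is the dimension.  Hall's condition then forces every vertex of degree at
   least 2 to see the whole opposite side.
   Sufficiency: for K_{m,m} a strand with a negative entry is a cone or sits in
   the top degree, for the path there is no room below the dimension, and for a
   matching one splits off the edges one at a time. *)
From HB Require Import structures.
Require Import Defs.
From mathcomp Require Import all_boot all_order all_algebra.
From mathcomp Require Import generic_quotient ring_quotient.
From mathcomp Require Import boolp.
From mathcomp Require Import mpoly.
From mathcomp Require Import ring zify.

Set Implicit Arguments.
Unset Strict Implicit.
Unset Printing Implicit Defensive.

Import GRing.Theory.
Local Open Scope ring_scope.
Local Open Scope quotient_scope.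

(** * Cochain complexes of families of finite sets *)

Section Strands.
Variables (k : fieldType) (n : nat).
Implicit Types (L : pred {set 'I_n}) (F G : {set 'I_n}) (i j v : 'I_n).
Implicit Types (phi psi : {set 'I_n} -> k).

(** The simplicial incidence sign of [F :\ i] in [F], for the vertex order of ['I_n]. *)
Definition face_sign i F : k := (-1) ^+ #|[set j in F | (j < i)%N]|.

Definition codiff phi F : k := \sum_(i in F) face_sign i F * phi (F :\ i).

Definition supported L phi := forall F, ~~ L F -> phi F = 0.

(** Exactness in degree [p] of the cochains on [L], the degree of a set being its cardinality.
    Cochains are total functions, so conditions are tested on members of [L] only. For [p = 0] the
    sum in [codiff] is empty, and [phi] must vanish at the empty set. *)
Definition strand_acyclic L (p : nat) := forall phi, supported L phi ->
  (forall F, L F -> #|F| = p.+1 -> codiff phi F = 0) ->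
  exists2 psi, supported L psi & forall F, L F -> #|F| = p -> phi F = codiff psi F.

Lemma face_sign_sqr i F : face_sign i F * face_sign i F = 1.
Proof. by rewrite /face_sign -expr2 sqrr_sign. Qed.

Lemma face_signU1 i v F : v \notin F ->
  face_sign i (v |: F) = (-1) ^+ (v < i)%N * face_sign i F.
Proof.
move=> vF; rewrite /face_sign -exprD; congr (_ ^+ _).
rewrite [LHS](cardsD1 v) [X in _ = (_ + X)%N](cardsD1 v) !inE eqxx (negPf vF) add0n /=.
congr (_ + #|pred_of_set _|)%N; apply/setP => j; rewrite !inE.
by case: eqP => [->|//].
Qed.

Lemma face_sign_swap i j F : i \in F -> j \in F -> i != j ->
  face_sign i F * face_sign j (F :\ i) = - (face_sign j F * face_sign i (F :\ j)).
Proof.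
move=> iF jF ij; set E := F :\ i :\ j.
have iE : i \notin E by rewrite !inE eqxx andbF.
have jE : j \notin E by rewrite !inE eqxx.
have Fi : F :\ i = j |: E by rewrite setD1K // !inE jF eq_sym ij.
have Fj : F :\ j = i |: E.
  by apply/setP => x; rewrite !inE; have [->|] := eqVneq x i; rewrite ?ij ?iF //=.
have -> : face_sign i F = face_sign i (i |: (j |: E)) by rewrite -Fi setD1K.
have -> : face_sign j F = face_sign j (j |: (i |: E)) by rewrite -Fj setD1K.
have jiE : j \notin i |: E by rewrite in_setU1 (negPf jE) orbF eq_sym.
have ijE : i \notin j |: E by rewrite in_setU1 (negPf iE) orbF.
rewrite Fi Fj !face_signU1 //.
rewrite !ltnn !mul1r.
have := ij; rewrite -val_eqE /=; case: ltngtP => // _ _; ring.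
Qed.

Lemma codiffB phi psi F : codiff (fun F => phi F - psi F) F = codiff phi F - codiff psi F.
Proof. by rewrite -sumrB; apply: eq_bigr => i _; rewrite mulrBr. Qed.

Lemma codiffD phi psi F : codiff (fun F => phi F + psi F) F = codiff phi F + codiff psi F.
Proof. by rewrite -big_split; apply: eq_bigr => i _; rewrite mulrDr. Qed.

(** Removing two vertices in either order gives the same set with opposite signs, so the terms with
    [i < j] cancel those with [j < i]. *)
Lemma codiff_codiff phi F : codiff (codiff phi) F = 0.
Proof.
pose A i j := face_sign i F * (face_sign j (F :\ i) * phi (F :\ i :\ j)).
have Asw i j : i \in F -> j \in F -> i != j -> A i j = - A j i.
  move=> iF jF ij; rewrite /A !mulrA face_sign_swap // mulNr.
  by congr (- (_ * phi _)); apply/setP => x; rewrite !inE andbCA.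
transitivity (\sum_(i in F) \sum_(j in F | i != j) A i j).
  apply: eq_bigr => i iF; rewrite /codiff mulr_sumr.
  by apply: eq_bigl => j; rewrite !inE eq_sym andbC.
transitivity (\sum_(i in F) (\sum_(j in F | (i < j)%N) A i j +
                             \sum_(j in F | (j < i)%N) A i j)).
  apply: eq_bigr => i iF.
  rewrite (bigID (fun j : 'I_n => (i < j)%N)) /=; congr (_ + _); apply: eq_bigl => j;
  by rewrite -val_eqE /=; case: ltngtP; rewrite ?andbT ?andbF.
rewrite big_split /= [X in _ + X](exchange_big_dep (mem F)) //=; last by move=> i j _ /andP[].
rewrite -big_split big1 //= => i iF.
have -> : \sum_(j in F | (i \in F) && (i < j)%N) A j i =
          - \sum_(j in F | (i < j)%N) A i j.
  rewrite -sumrN; apply: eq_big => [j|j /and3P[jF _ ij]]; first by rewrite iF.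
  by rewrite Asw // eq_sym -val_eqE /= neq_ltn ij.
by rewrite subrr.
Qed.


(** Contracting homotopy: [psi F] is the signed value of [phi] at [v |: F]. On sets containing [v]
    only the term removing [v] survives; on the others the cocycle condition at [v |: F] gives the
    claim. *)
Lemma strand_acyclic_cone L v p :
  (forall F, L F -> L (v |: F) /\ L (F :\ v)) -> strand_acyclic L p.
Proof.
move=> Lv phi phiL dphi.
pose psi F := if v \in F then 0 else face_sign v (v |: F) * phi (v |: F).
exists psi => [F nLF|F LF Fp].
  rewrite /psi; case: ifP => // vF; rewrite phiL ?mulr0 //.
  by apply: contra nLF => /Lv[_]; rewrite setU1K // vF.
rewrite /codiff; have [vF|vF] := boolP (v \in F).
  rewrite (bigD1 v) //= big1 ?addr0 => [|i /andP[iF iv]].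
    by rewrite /psi !inE eqxx /= setD1K // mulrA face_sign_sqr mul1r.
  by rewrite /psi !inE eq_sym iv vF mulr0.
have vFp : #|v |: F| = p.+1 by rewrite cardsU1 vF Fp.
have /eqP := dphi (v |: F) (Lv _ LF).1 vFp.
rewrite /codiff (bigD1 v) ?setU11 //= setU1K // addrC addr_eq0 => /eqP e.
rewrite -[LHS]mul1r -(face_sign_sqr v (v |: F)) -mulrA.
rewrite -[_ * phi F]opprK -{}e mulrN -mulrN -sumrN mulr_sumr.
rewrite [LHS](eq_bigl (fun i => i \in F)) => [|i]; last first.
  by rewrite !inE; have [->|] := eqVneq i v; rewrite ?(negPf vF) ?andbT.
apply: eq_bigr => i iF; have iv : i != v by apply: contraNneq vF => <-.
have vFi : v \in v |: F by rewrite setU11.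
have iFv : i \in v |: F by rewrite !inE iF orbT.
have -> : psi (F :\ i) = face_sign v ((v |: F) :\ i) * phi ((v |: F) :\ i).
  have -> : (v |: F) :\ i = v |: (F :\ i).
    by apply/setP => x; rewrite !inE; have [->|] := eqVneq x v; rewrite ?(eq_sym v) ?iv.
  by rewrite /psi !inE (negPf vF) andbF.
have := face_sign_swap vFi iFv; rewrite eq_sym => /(_ iv).
rewrite setU1K // => e; rewrite mulrN mulrA -mulNr.
rewrite -[face_sign i F]mul1r -(face_sign_sqr v (v |: F)) -(mulrA _ _ (face_sign i F)) e.
rewrite mulrN !mulNr; congr (- _).
by rewrite -!mulrA (mulrA (face_sign v (_ :\ i))) face_sign_sqr mul1r.
Qed.

(** Cochains supported on sets containing [y] form a subcomplex, with the complex of the sets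
    avoiding [y] as quotient; this is the middle term of the long exact sequence. Convexity of [L]
    makes the coboundary truncated to [L] square to zero. *)
Lemma strand_acyclic_split L y p :
  (forall A B C : {set 'I_n}, A \subset B -> B \subset C -> L A -> L C -> L B) ->
  strand_acyclic [pred F | L F && (y \notin F)] p ->
  strand_acyclic [pred F | L F && (y \in F)] p -> strand_acyclic L p.
Proof.
move=> Lconv ac1 ac2 phi phiL dphi.
pose phi1 F := if y \in F then 0 else phi F.
have [||psi1 psi1L dpsi1] := ac1 phi1.
- move=> F /=; rewrite /phi1 negb_and negbK; case: ifP => // _; rewrite orbF; exact: phiL.
- move=> F /= /andP[LF yF] Fp; rewrite -[RHS](dphi F) //.
  by apply: eq_bigr => i _; rewrite /phi1 !inE (negPf yF) andbF.
(* A primitive is found off [y] first; in degree [p] the error [phi - dpsi] is then supported on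
   sets containing [y]. *)
pose dpsi F := if L F then codiff psi1 F else 0.
have [||psi2 psi2L dpsi2] := ac2 (fun F => if #|F| == p then phi F - dpsi F else 0).
- move=> F /=; rewrite negb_and; case: eqP => // Fp.
  have [LF /=|nLF _] := boolP (L F); last by rewrite /dpsi (negPf nLF) phiL ?subr0.
  by move=> yF; rewrite /dpsi LF -dpsi1 /= ?LF ?yF // /phi1 (negPf yF) subrr.
- move=> F /= /andP[LF yF] Fp; transitivity (codiff phi F - codiff (codiff psi1) F); last first.
    by rewrite dphi // codiff_codiff subr0.
  rewrite -codiffB; apply: eq_bigr => i iF.
  have -> : #|F :\ i| == p by have := cardsD1 i F; rewrite iF Fp add1n => -[->].
  rewrite /dpsi; case: ifP => // /negP nLFi.
  rewrite [codiff psi1 _]big1 // => j jF; rewrite psi1L ?mulr0 //= negb_and.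
  apply/orP; left; apply/negP => LFij; apply: nLFi.
  by apply: Lconv LFij LF; rewrite ?subD1set.
exists (fun F => psi1 F + psi2 F) => [F nLF|F LF Fp].
  by rewrite psi1L ?psi2L ?addr0 //= (negPf nLF).
rewrite codiffD; have [yF|yF] := boolP (y \in F).
  by rewrite -dpsi2 /= ?LF ?yF // Fp eqxx /dpsi LF addrC subrK.
rewrite -dpsi1 /= ?LF ?yF // /phi1 (negPf yF) [X in _ + X]big1 ?addr0 // => i iF.
by rewrite psi2L ?mulr0 //= !inE (negPf yF) !andbF.
Qed.

End Strands.

(** * The symbolic square as a monomial ideal *)

Section MonomialIdeals.
Variables (k : fieldType) (n : nat) (e : rel 'I_n).
Implicit Types (p q : {mpoly k[n]}) (m : 'X_{1..n}) (F : {set 'I_n}).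

Definition facet F := maxset (independent e) F.

Definition codeg F m := (\sum_(j | j \notin F) m j)%N.

(** The power [P_F^r] described by exponents, so that membership becomes a condition on single
    coefficients. *)
Definition codeg_ideal F r : {pred {mpoly k[n]}^o} := fun p : {mpoly k[n]} =>
  `[< forall m, (codeg F m < r)%N -> p@_m = 0 >].

Lemma codegD F m1 m2 : codeg F (m1 + m2)%MM = (codeg F m1 + codeg F m2)%N.
Proof. by rewrite -big_split; apply: eq_bigr => j _; rewrite mnmDE. Qed.

Lemma codeg_idealM F r s p q :
  p \in codeg_ideal F r -> q \in codeg_ideal F s -> p * q \in codeg_ideal F (r + s).
Proof.
move=> /asboolP hp /asboolP hq; apply/asboolP => m hm.
rewrite mcoeffM big1 // => -[m1 m2] /= /eqP mE.
have [lt1|le1] := ltnP (codeg F m1) r; first by rewrite hp ?mul0r.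
rewrite hq ?mulr0 //; have := codegD F m1 m2; rewrite -mE; lia.
Qed.

Lemma codeg_ideal_submod F r : submod_closed (codeg_ideal F r).
Proof.
split; first by apply/asboolP => m _; rewrite mcoeff0.
move=> a p q hp /asboolP hq; apply/asboolP => m hm.
rewrite mcoeffD (hq m hm) addr0.
have : a \in codeg_ideal F 0 by apply/asboolP.
by move=> /codeg_idealM/(_ hp)/asboolP; apply.
Qed.

HB.instance Definition _ F r := GRing.isSubmodClosed.Build _ _ (codeg_ideal F r)
  (codeg_ideal_submod F r).

Lemma mem_ideal_gen (R : comNzRingType) (P : R -> Prop) a : P a -> a \in ideal_gen P.
Proof. by move=> Pa; apply/asboolP => J; apply. Qed.

(** Generators lie in [codeg_ideal F 1], so their products lie in [codeg_ideal F 2]. Conversely a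
    monomial of degree at least 2 outside [F] is a multiple of a product of two such variables. *)
Lemma mem_prime_of_sqr F p :
  reflect (forall m, (codeg F m < 2)%N -> p@_m = 0)
    (p \in ideal_mul (prime_of k F) (prime_of k F)).
Proof.
apply: (iffP idP) => [/asboolP/(_ (codeg_ideal F 2 : submodClosed _)) hp|hp].
  have /asboolP // : p \in codeg_ideal F 2.
  apply: hp => a [x [y [/asboolP/(_ (codeg_ideal F 1 : submodClosed _)) hx
     /asboolP/(_ (codeg_ideal F 1 : submodClosed _)) hy ->]]].
  have X1 z : (exists2 j, j \notin F & z = 'X_j :> {mpoly k[n]}) -> z \in codeg_ideal F 1.
    move=> [j jF ->]; apply/asboolP => m; rewrite ltnS leqn0 => /eqP m0.
    rewrite mcoeffX; case: eqP => // mE; move: m0; rewrite -mE /codeg.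
    by rewrite (bigD1 j) //= mnm1E eqxx.
  by have := codeg_idealM (hx X1) (hy X1).
have pick1 m : (0 < codeg F m)%N -> exists2 j, j \notin F & exists m', m = (U_(j) + m')%MM.
  rewrite lt0n sum_nat_eq0 negb_forall => /existsP[j]; rewrite negb_imply.
  move=> /andP[jF mj]; exists j => //; exists (m - U_(j))%MM.
  rewrite addmC submK //; apply/mnm_lepP => i; rewrite mnm1E; case: eqP => [<-|//].
  by rewrite lt0n.
rewrite [p]mpolyE; apply: rpred_sum => m _.
have [lt2|le2] := ltnP (codeg F m) 2; first by rewrite hp // scale0r rpred0.
have [|i iF [m1 mE]] := pick1 m; first by lia.
have [|j jF [m2 m1E]] := pick1 m1.
  move: le2; rewrite mE codegD {1}/codeg (bigD1 i) //= big1 => [|l /andP[_ li]].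
    by rewrite mnm1E eqxx; lia.
  by rewrite mnm1E eq_sym (negPf li).
rewrite mE m1E addmA mpolyXD -mul_mpolyC mulrA mulrAC.
apply: (@rpredZ _ {mpoly k[n]}^o _ (_ * _)).
rewrite mpolyXD; apply: mem_ideal_gen; exists 'X_i, 'X_j; split => //.
  by apply: mem_ideal_gen; exists i.
by apply: mem_ideal_gen; exists j.
Qed.

(** The exponents of the monomials outside the symbolic square. *)
Definition standard m := [exists F, facet F && (codeg F m < 2)%N].

Lemma symbolic_squareP p :
  reflect (forall m, standard m -> p@_m = 0) (p \in symbolic_square k e).
Proof.
apply: (@iffP (forall F, facet F -> p \in ideal_mul (prime_of k F) (prime_of k F))).
- exact: asboolP.
- move=> hp m /existsP[F /andP[Fm lt2]].
  by have /mem_prime_of_sqr := hp F Fm; apply.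
move=> hp F Fm.
by apply/mem_prime_of_sqr => m lt2; apply: hp; apply/existsP; exists F; apply/andP.
Qed.

Implicit Types a : {ffun 'I_n -> int}.

(* Laurent monomials are encoded by integer exponent vectors; coefficients at
   vectors with a negative entry are 0. *)
Definition zcoeff (a : {ffun 'I_n -> int}) p : k :=
  if [forall i, 0 <= a i] then p@_[multinom `|a i|%N | i < n] else 0.

Lemma zcoeff_linear a c p q : zcoeff a (c *: p + q) = c * zcoeff a p + zcoeff a q.
Proof. by rewrite /zcoeff; case: ifP => _; rewrite ?mcoeffD ?mcoeffZ // mulr0 addr0. Qed.

Lemma zcoeffB a p q : zcoeff a (p - q) = zcoeff a p - zcoeff a q.
Proof. by rewrite -[p - q]addrC -scaleN1r zcoeff_linear mulN1r addrC. Qed.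

Lemma zcoeff_nat m p : zcoeff [ffun i => (m i)%:Z] p = p@_m.
Proof.
rewrite /zcoeff ifT; last by apply/forallP => i; rewrite ffunE.
by congr (p@_ _); apply/mnmP => i; rewrite mnmE ffunE.
Qed.

Lemma zcoeff_neg a p i : a i < 0 -> zcoeff a p = 0.
Proof.
by move=> ai; rewrite /zcoeff ifN //; apply/forallPn; exists i; rewrite -Order.TotalTheory.ltNge.
Qed.

Lemma zcoeff_mnm a p : (forall i, 0 <= a i) ->
  zcoeff a p = p@_[multinom `|a i|%N | i < n].
Proof. by move=> a0; rewrite /zcoeff ifT //; apply/forallP. Qed.

Lemma zcoeffXM m p a : zcoeff a ('X_[m] * p) = zcoeff [ffun i => a i - (m i)%:Z] p.
Proof.
rewrite mulrC; rewrite /zcoeff; case: ifP => [/forallP a0|/forallPn[i ai]].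
  case: ifP => [/forallP am0|/forallPn[i]].
    rewrite -(mcoeffMX p m); congr (_@_ _); apply/mnmP => i.
    by rewrite mnmDE !mnmE; have := a0 i; have := am0 i; rewrite ffunE; lia.
  rewrite ffunE => ai; apply/eqP; rewrite mcoeff_eq0.
  rewrite (perm_mem (msuppMX p m)); apply/mapP => -[m' _] /mnmP/(_ i).
  by rewrite mnmDE mnmE; have := a0 i; lia.
rewrite ifN //; apply/forallPn; exists i; rewrite ffunE; lia.
Qed.

End MonomialIdeals.

(** * Laurent coefficients in localizations *)

Section LaurentCoefficients.
Variables (k : fieldType) (n : nat) (e : rel 'I_n).
Implicit Types (F : {set 'I_n}) (a b : {ffun 'I_n -> int}) (m : 'X_{1..n}).

Local Notation S := {mpoly k[n]}.
Local Notation M := (quotmod (symbolic_square k e)).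
Local Notation xprod F := (\prod_(i in F) ('X_i : S)).

(** Holds exactly when the degree [a] part of the localization of [M] at [xprod F] is nonzero; that
    part is then a line. *)
Definition live a F : bool :=
  [forall i, (a i < 0) ==> (i \in F)] &&
  [exists F' : {set 'I_n}, [&& facet e F', F \subset F' & \sum_(j | j \notin F') a j <= 1]].

Definition shift a F t : {ffun 'I_n -> int} := [ffun i => a i + (t * (i \in F))%N%:Z].

(** The coefficient of [x^a] in a fraction is read off the numerator at the exponent [shift a F t].
    In dead degrees it would depend on the numerator chosen, so it is set to 0. *)
Definition lcoeff F a (u : loc M (xprod F)) : k :=
  let: (q, t) := repr u in
  if live a F then zcoeff (shift a F t) (repr q) else 0.

Lemma xprodX F t : xprod F ^+ t = 'X_[[multinom (t * (i \in F))%N | i < n]].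
Proof.
have -> : xprod F = 'X_[\sum_(i in F) U_(i)].
  by rewrite (big_morph _ (@mpolyXD n k) (mpolyX0 n k)).
rewrite mpolyXn; congr 'X_[_]; apply/mnmP => i.
rewrite mulmnE mnm_sumE mnmE mulnC; congr (_ * _)%N.
have [iF|iF] := boolP (i \in F).
  rewrite (bigD1 i) //= big1 ?mnm1E ?eqxx // => j /andP[_ ji].
  by rewrite mnm1E (negPf ji).
rewrite big1 // => j jF; rewrite mnm1E; case: eqP => // ji.
by rewrite -ji jF in iF.
Qed.

Lemma pi_quotmod_eq (R : comNzRingType) (V : lmodType R) (N : submodClosed V) (x y : V) :
  (\pi_(quotmod N) x == \pi_(quotmod N) y) = (x - y \in N).
Proof. by rewrite -Quotient.idealrBE. Qed.

(** The shift changes only entries in [F], hence inside [F'], so the weight outside [F'] stays at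
    most 1 and the exponent is standard or has a negative entry. *)
Lemma live_zcoeff a F t (p : S) : live a F -> p \in symbolic_square k e ->
  zcoeff (shift a F t) p = 0.
Proof.
move=> /andP[/forallP neg /existsP[F' /and3P[F'm FF' le1]]] /symbolic_squareP hp.
have [/forallP ge0|/forallPn[i]] := boolP [forall i, 0 <= shift a F t i]; last first.
  by rewrite -Order.TotalTheory.ltNge; apply: zcoeff_neg.
rewrite zcoeff_mnm // hp //; apply/existsP; exists F'; rewrite F'm /=.
suff : ((codeg F' [multinom `|shift a F t i|%N | i < n])%:Z <= 1) by rewrite ltnS.
apply: Order.POrderTheory.le_trans le1; rewrite /codeg (big_morph Posz PoszD (erefl (Posz 0))).
apply: Num.Theory.ler_sum => j jF'; rewrite mnmE.
have jF : j \notin F by apply: contra jF'; apply: (subsetP FF').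
have := ge0 j. rewrite ffunE (negPf jF) muln0 addr0; case: (a j) => //.
Qed.

Lemma zcoeff_shift a F s t (p : S) :
  zcoeff (shift a F (s + t)) (xprod F ^+ s * p) = zcoeff (shift a F t) p.
Proof.
rewrite xprodX zcoeffXM; congr (zcoeff _ p); apply/ffunP => i.
by rewrite !ffunE mnmE mulnDl PoszD [(Posz _ + Posz _)]addrC addrA addrK.
Qed.

(** After clearing denominators, two numerators of one fraction differ by an element of the symbolic
    square, to which [live_zcoeff] applies. *)
Lemma lcoeffE F a (p : S) t :
  lcoeff a (loc_frac (xprod F) (\pi_M p) t) =
  if live a F then zcoeff (shift a F t) p else 0.
Proof.
rewrite /lcoeff; have [q [s [c [-> h]]]] := loc_repr (xprod F) (\pi_M p) t.
case: ifP => // lv; move: h; rewrite -{1}[q]reprK => h.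
have /eqP := h; rewrite -[X in X == _]/(quotmod_scale _ _) -[X in _ == X]/(quotmod_scale _ _).
rewrite !pi_quotmod_scale pi_quotmod_eq => inJ.
have := live_zcoeff (c + t + s) lv inJ.
rewrite (_ : zcoeff _ _ = zcoeff (shift a F (c + t + s)) (xprod F ^+ (c + t) * repr q) -
   zcoeff (shift a F (c + s + t)) (xprod F ^+ (c + s) * p)).
  by rewrite !zcoeff_shift => /eqP; rewrite subr_eq0 => /eqP.
by rewrite [(c + s + t)%N]addnAC -zcoeffB.
Qed.

Lemma loc_quot_ind F (P : loc M (xprod F) -> Prop) :
  (forall (p : S) t, P (loc_frac (xprod F) (\pi_M p) t)) -> forall u, P u.
Proof. by move=> h; elim/loc_ind => m t; elim/quotmod_ind: m. Qed.

Lemma pi_quotZ (c p : S) : c *: \pi_M p = \pi_M (c * p).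
Proof. exact: pi_quotmod_scale. Qed.

Lemma pi_quotD (p q : S) : \pi_M p + \pi_M q = \pi_M (p + q).
Proof. by rewrite pi_quotmodD. Qed.

Lemma loc_quotD F (p q : S) s t :
  loc_frac (xprod F) (\pi_M p) s + loc_frac (xprod F) (\pi_M q) t =
  loc_frac (xprod F) (\pi_M (xprod F ^+ t * p + xprod F ^+ s * q)) (s + t).
Proof.
by rewrite [LHS]loc_addE !pi_quotZ pi_quotD.
Qed.

Lemma loc_quotZ F (c p : S) t :
  c *: loc_frac (xprod F) (\pi_M p) t = loc_frac (xprod F) (\pi_M (c * p)) t.
Proof. by rewrite [LHS]loc_scaleE pi_quotZ. Qed.

Lemma lcoeffD F a : {morph @lcoeff F a : u v / u + v}.
Proof.
elim/loc_quot_ind => p s; elim/loc_quot_ind => q t.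
rewrite loc_quotD !lcoeffE; case: ifP => _; last by rewrite addr0.
rewrite -[xprod F ^+ t * p]scale1r zcoeff_linear mul1r zcoeff_shift.
by rewrite addnC zcoeff_shift.
Qed.

Lemma lcoeffXZ F a m (u : loc M (xprod F)) :
  lcoeff a ('X_[m] *: u) = if live a F then lcoeff [ffun i => a i - (m i)%:Z] u else 0.
Proof.
elim/loc_quot_ind: u => p t; rewrite loc_quotZ !lcoeffE.
have [lv|//] := ifP; rewrite zcoeffXM.
have -> : [ffun i => shift a F t i - (m i)%:Z] = shift [ffun i => a i - (m i)%:Z] F t.
  by apply/ffunP => i; rewrite !ffunE addrAC.
(* Lowering a live [a] does not raise the weight outside [F'], so only a negative entry outside [F]
   can make it dead, and then the numerator has coefficient 0. *)
case: ifPn => // nlv.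
move: lv nlv => /andP[/forallP neg /existsP[F' /and3P[F'm FF' le1]]].
rewrite negb_and => /orP[/forallPn[i]|/existsPn/(_ F')].
  rewrite negb_imply ffunE => /andP[ai iF]; apply: (@zcoeff_neg _ _ _ _ i).
  by rewrite !ffunE (negPf iF) muln0 addr0.
rewrite F'm FF' /= => /negP[]; apply: Order.POrderTheory.le_trans le1.
by apply: Num.Theory.ler_sum => j _; rewrite ffunE; lia.
Qed.

Lemma lcoeffCZ F a c (u : loc M (xprod F)) : lcoeff a (c%:MP *: u) = c * lcoeff a u.
Proof.
elim/loc_quot_ind: u => p t; rewrite loc_quotZ !lcoeffE; case: ifP => _; last by rewrite mulr0.
by rewrite mul_mpolyC -[c *: p]addr0 zcoeff_linear -(subrr p) zcoeffB subrr addr0.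
Qed.

Lemma lcoeff0 F a : lcoeff a (0 : loc M (xprod F)) = 0.
Proof. by apply: (addrI (lcoeff a (0 : loc M (xprod F)))); rewrite -lcoeffD !addr0. Qed.

Lemma lcoeff_sum F a (I : Type) (r : seq I) (P : pred I) (u : I -> loc M (xprod F)) :
  lcoeff a (\sum_(i <- r | P i) u i) = \sum_(i <- r | P i) lcoeff a (u i).
Proof. exact: (big_morph _ (@lcoeffD F a) (lcoeff0 F a)). Qed.

Lemma lcoeff_dead F a (u : loc M (xprod F)) : ~~ live a F -> lcoeff a u = 0.
Proof. by elim/loc_quot_ind: u => p t nlv; rewrite lcoeffE (negPf nlv). Qed.

Lemma live_subset a F F0 : live a F -> F0 \subset F ->
  (forall i, a i < 0 -> i \in F0) -> live a F0.
Proof.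
move=> /andP[_ /existsP[F' /and3P[F'm FF' le1]]] F0F neg; apply/andP; split.
  by apply/forallP => i; apply/implyP/neg.
by apply/existsP; exists F'; rewrite F'm le1 (subset_trans F0F FF').
Qed.

(** The factor ['X_i ^+ t] compensates exactly for the larger denominator. A degree live for [F1]
    but dead for [F] has [a i < 0], where a fraction over [xprod F] has coefficient 0. *)
Lemma lcoeff_map F F1 a i (u : loc M (xprod F)) : i \notin F -> F1 = i |: F ->
  lcoeff a (loc_map (xprod F1) 'X_i u) = if live a F1 then lcoeff a u else 0.
Proof.
move=> iF ->; have xE : xprod (i |: F) = xprod F * 'X_i by rewrite big_setU1 //= mulrC.
elim/loc_quot_ind: u => p t; rewrite loc_mapE // pi_quotZ !lcoeffE.
have [lv|//] := ifP; rewrite mpolyXn zcoeffXM.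
have -> : [ffun j => shift a (i |: F) t j - ((U_(i) *+ t)%MM j)%:Z] = shift a F t.
  apply/ffunP => j; rewrite !ffunE mulmnE mnm1E in_setU1 [i == j]eq_sym.
  have [->|_] := eqVneq j i; last by rewrite mul0n subr0.
  by rewrite (negPf iF) muln0 muln1 mul1n addr0 addrK.
have [//|nlv] := ifPn; have [ai|ai] := boolP (a i < 0).
  by apply: (@zcoeff_neg _ _ _ _ i); rewrite !ffunE (negPf iF) muln0 addr0.
case/negP: nlv; apply: (live_subset lv); rewrite ?subsetUr // => j aj.
have /andP[/forallP/(_ j)/implyP/(_ aj) + _] := lv.
by rewrite !inE; case: eqP => // ji; rewrite ji (negPf ai) in aj.
Qed.

Lemma lcoeff_inj F (u : loc M (xprod F)) : (forall a, lcoeff a u = 0) -> u = 0.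
Proof.
(* The factor [xprod F ^+ 2] disposes of the maximal independent sets [F'] not containing [F]: it
   puts the square of a variable outside [F'] into every monomial. For [F'] containing [F], the
   degree [a] chosen below is live. *)
elim/loc_quot_ind: u => p t u0; apply/loc_fracP; exists 2.
rewrite scaler0 addn0 pi_quotZ; have -> : 0 = \pi_M 0 by rewrite -(scale0r (\pi_M p)) pi_quotZ mul0r.
apply/eqP; rewrite pi_quotmod_eq subr0; apply/symbolic_squareP => m /existsP[F' /andP[F'm le1]].
pose a : {ffun 'I_n -> int} := [ffun i => (m i)%:Z - ((t + 2) * (i \in F))%N%:Z].
have <- : zcoeff (shift a F (2 + t)) (xprod F ^+ 2 * p) = (xprod F ^+ 2 * p)@_m.
  rewrite -zcoeff_nat; congr (zcoeff _ _); apply/ffunP => i; rewrite !ffunE.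
  by rewrite (addnC 2) subrK.
rewrite zcoeff_shift; have := u0 a; rewrite lcoeffE; case: ifP => // /negP nlv _.
have [FF'|/subsetPn[j jF jF']] := boolP (F \subset F').
  case: nlv; apply/andP; split.
    by apply/forallP => i; apply/implyP; rewrite ffunE; case: (i \in F) => //=; lia.
  apply/existsP; exists F'; rewrite F'm FF' /=.
  rewrite (eq_bigr (fun j => (m j)%:Z)) => [|j jF'].
    by rewrite -(big_morph Posz PoszD (erefl (Posz 0))).
  rewrite ffunE; have /negPf-> : j \notin F by apply: contra jF'; apply: (subsetP FF').
  by rewrite muln0 subr0.
apply: (@zcoeff_neg _ _ _ _ j); rewrite !ffunE jF !muln1.
suff : (m j <= 1)%N by lia.
by move: le1; rewrite /codeg (bigD1 j) //=; lia.
Qed.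

Lemma lcoeff_finsupp F (u : loc M (xprod F)) :
  exists s : seq {ffun 'I_n -> int}, forall a, lcoeff a u != 0 -> a \in s.
Proof.
elim/loc_quot_ind: u => p t.
exists [seq [ffun i => (m i)%:Z - (t * (i \in F))%N%:Z] | m : 'X_{1..n} <- msupp p] => a.
rewrite lcoeffE; case: ifP => _; rewrite ?eqxx // /zcoeff.
case: ifP => [/forallP a0|]; rewrite ?eqxx // -mcoeff_msupp => min.
apply/mapP; exists [multinom `|shift a F t i|%N | i < n] => //.
apply/ffunP => i; have := a0 i; rewrite !ffunE mnmE !ffunE => ge0.
by rewrite gez0_abs // addrK.
Qed.

(** The Laurent monomial [x^a], meant for live [a]; the denominator exponent [t] is large enough to
    clear every negative entry. *)
Definition lmon F a : loc M (xprod F) :=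
  let t := (\sum_i `|a i|)%N in
  loc_frac (xprod F) (\pi_M 'X_[[multinom `|shift a F t i|%N | i < n]]) t.

Lemma lcoeff_lmon F a b : live a F -> lcoeff b (lmon F a) = (a == b)%:R.
Proof.
move=> lv; rewrite /lmon; set t := (\sum_i _)%N; rewrite lcoeffE.
have ge0 i : 0 <= shift a F t i.
  rewrite ffunE; have [iF|iF] := boolP (i \in F); last first.
    rewrite muln0 addr0 Order.TotalTheory.leNgt; apply: contra iF => ai.
    by have /andP[/forallP/(_ i)/implyP/(_ ai)] := lv.
  by have : (`|a i| <= t)%N; [rewrite /t (bigD1 i) //= leq_addr | lia].
have [<-|ab] := eqVneq a b.
  by rewrite lv zcoeff_mnm // mcoeffX eqxx.
case: ifP => // lvb; rewrite /zcoeff; case: ifP => // /forallP b0.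
rewrite mcoeffX; case: eqP => // /mnmP abE; case/eqP: ab; apply/ffunP => i.
have := congr1 Posz (abE i); rewrite !mnmE !gez0_abs ?(b0 i) ?ge0 //.
by rewrite !ffunE => /addIr.
Qed.

End LaurentCoefficients.

(** * Strands of the Cech complex *)

Section CechStrands.
Variables (k : fieldType) (n : nat) (e : rel 'I_n).
Implicit Types (F : {set 'I_n}) (a b : {ffun 'I_n -> int}) (m : 'X_{1..n}) (p : nat).

Local Notation S := {mpoly k[n]}.
Local Notation M := (quotmod (symbolic_square k e)).
Local Notation x := (fun i : 'I_n => 'X_i : S).
Local Notation cech := (cech x M).

(** The degree [a] part of a Cech cochain as a function on all sets, 0 off cardinality [p]; this
    avoids types depending on the cardinality. *)
Definition strand p (u : cech p) a F : k :=
  if insub F is Some G then lcoeff a (u G) else 0.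

Lemma strand_val p (u : cech p) a (G : subset_of_card n p) :
  strand u a (val G) = lcoeff a (u G).
Proof. by rewrite /strand valK. Qed.

Lemma strand_card p (u : cech p) a F : #|F| != p -> strand u a F = 0.
Proof. by move=> Fp; rewrite /strand insubN. Qed.

Lemma strandP p (u : cech p) a F c :
  (forall G : subset_of_card n p, val G = F -> lcoeff a (u G) = c) ->
  #|F| == p -> strand u a F = c.
Proof. by move=> h Fp; rewrite -[F]/(val (Sub F Fp : subset_of_card n p)) strand_val h. Qed.

Lemma strandD p a F : {morph (fun u : cech p => strand u a F) : u v / u + v}.
Proof.
move=> u v /=; rewrite /strand; case: insubP => [G _ _|_]; last by rewrite addr0.
by rewrite ffunE lcoeffD.
Qed.

Lemma strand0 p a F : strand (0 : cech p) a F = 0.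
Proof. by apply: (addrI (strand (0 : cech p) a F)); rewrite -strandD !addr0. Qed.

Lemma strandCZ p a F c (u : cech p) : strand (c%:MP *: u) a F = c * strand u a F.
Proof.
rewrite /strand; case: insubP => [G _ _|_]; last by rewrite mulr0.
by rewrite ffunE lcoeffCZ.
Qed.

Lemma strandXZ p a F m (u : cech p) : strand ('X_[m] *: u) a F =
  if live e a F then strand u [ffun i => a i - (m i)%:Z] F else 0.
Proof.
rewrite /strand; case: insubP => [G _ <-|_]; last by rewrite if_same.
by rewrite ffunE lcoeffXZ.
Qed.

Lemma strandB p a F (u v : cech p) : strand (u - v) a F = strand u a F - strand v a F.
Proof.
have -> : u - v = (-1)%:MP *: v + u by rewrite mpolyCN mpolyC1 scaleN1r addrC.
by rewrite strandD strandCZ mulN1r addrC.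
Qed.

Lemma strand_sum p a F (I : Type) (r : seq I) (P : pred I) (u : I -> cech p) :
  strand (\sum_(i <- r | P i) u i) a F = \sum_(i <- r | P i) strand (u i) a F.
Proof. exact: (big_morph (fun u => strand u a F) (strandD a F) (strand0 p a F)). Qed.

Lemma strand_supported p (u : cech p) a : supported (live e a) (strand u a).
Proof.
by move=> F nlv; rewrite /strand; case: insubP => // G _ GF; rewrite lcoeff_dead // GF.
Qed.

Lemma strand_inj p (u v : cech p) : (forall a F, strand u a F = strand v a F) -> u = v.
Proof.
move=> h; apply/ffunP => G; apply/eqP; rewrite -subr_eq0; apply/eqP.
apply: lcoeff_inj => a; have := h a (val G); rewrite !strand_val => uv.
by rewrite lcoeffD uv -lcoeffD addrN lcoeff0.
Qed.

(** The localization maps preserve coefficients in degrees live for the target. At a dead [F] the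
    left side is 0 while [codiff] need not be. *)
Lemma strand_diff p (u : cech p) a F : live e a F -> #|F| = p.+1 ->
  strand (cech_diff u) a F = codiff (strand u a) F.
Proof.
move=> lv cF; have /eqP Fp := cF; apply: strandP Fp => H HF; rewrite ffunE /=.
rewrite lcoeff_sum (eq_bigr (fun G : subset_of_card n p =>
  \sum_(i | (i \notin val G) && (val H == i |: val G)) face_sign k i F * strand u a (val G))).
  rewrite (exchange_big_dep (mem F)) /=; last by move=> G i _ /andP[_ /eqP]; rewrite HF => ->; rewrite setU11.
  apply: eq_bigr => i iF; rewrite -mulr_sumr; congr (_ * _).
  have cFi : #|F :\ i| == p.
    by have := cardsD1 i F; rewrite iF cF add1n => -[->].
  rewrite (big_pred1 (Sub (F :\ i) cFi : subset_of_card n p)) // => G /=.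
  rewrite HF; apply/andP/eqP => [[iG /eqP FE]|->] /=.
    by apply: val_inj; rewrite /= FE setU1K.
  by rewrite !inE eqxx setD1K.
move=> G _; rewrite lcoeff_sum; apply: eq_bigr => i /andP[iG /eqP HE].
rewrite strand_val.
have -> : (-1) ^+ #|[set j in val H | (j < i)%N]| = (face_sign k i F)%:MP :> S.
  by rewrite HF /face_sign rmorphXn rmorphN1.
rewrite lcoeffCZ; congr (_ * _).
by rewrite (lcoeff_map _ _ iG HE) HF lv.
Qed.

Definition cech_mono p (phi : {set 'I_n} -> k) a : cech p :=
  dirprod_mk (fun G : subset_of_card n p => (phi (val G))%:MP *: lmon k e (val G) a).

Lemma strand_mono p phi a b F : supported (live e a) phi -> #|F| = p ->
  strand (cech_mono p phi a) b F = (a == b)%:R * phi F.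
Proof.
move=> phiL /eqP Fp; apply: strandP Fp => G GF; rewrite ffunE lcoeffCZ GF.
have [lv|nlv] := boolP (live e a F); last by rewrite phiL // mulr0 mul0r.
by rewrite lcoeff_lmon ?GF // mulrC.
Qed.

Lemma strand_diff_eq p (u : cech p) (v : cech p.+1) :
  (forall a F, live e a F -> #|F| = p.+1 -> strand v a F = codiff (strand u a) F) ->
  v = cech_diff u.
Proof.
move=> h; apply: strand_inj => a F.
have [/eqP Fp|Fp] := boolP (#|F| == p.+1); last by rewrite !strand_card.
have [lv|nlv] := boolP (live e a F); last by rewrite !strand_supported.
by rewrite strand_diff ?h.
Qed.

Lemma codiff_eq phi psi F : (forall i, i \in F -> phi (F :\ i) = psi (F :\ i)) ->
  codiff phi F = codiff psi F :> k.
Proof. by move=> h; apply: eq_bigr => i iF; rewrite h. Qed.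

Lemma strand_finsupp p (u : cech p) :
  exists s : seq {ffun 'I_n -> int}, forall a F, strand u a F != 0 -> a \in s.
Proof.
have /choice[s sP] (G : subset_of_card n p) := lcoeff_finsupp (u G).
exists (flatten [seq s G | G <- enum {: subset_of_card n p}]) => a F.
rewrite /strand; case: insubP => [G _ _ uG|_]; last by rewrite eqxx.
by apply/flattenP; exists (s G); [apply: map_f; rewrite mem_enum | apply: sP].
Qed.

(** Only finitely many degrees occur in [u], so the primitives of its strands add up to one Cech
    cochain. *)
Lemma coboundary_strands p (u : cech p) :
  (forall a, exists2 psi, supported (live e a) psi &
     forall F, live e a F -> #|F| = p -> strand u a F = codiff psi F) ->
  coboundary u.
Proof.
move=> ex_psi; have /choice[psi psiP] a : exists psi, supported (live e a) psi /\
     forall F, live e a F -> #|F| = p -> strand u a F = codiff psi F.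
  by have [psi] := ex_psi a; exists psi.
case: p u psiP {ex_psi} => [|p] u psiP /=.
  apply: strand_inj => a F; rewrite strand0.
  have [/eqP Fp|Fp] := boolP (#|F| == 0%N); last by rewrite strand_card.
  have [lv|nlv] := boolP (live e a F); last by rewrite strand_supported.
  have [_ ->//] := psiP a; move/eqP: Fp; rewrite cards_eq0 => /eqP->.
  by rewrite /codiff big_set0.
have [s sP] := strand_finsupp u.
pose v : cech p := \sum_(a <- undup s) cech_mono p (psi a) a.
exists v; apply: strand_diff_eq => a F lv Fp; have [psiL psiE] := psiP a.
have vE F' : #|F'| = p -> strand v a F' = (a \in s)%:R * psi a F'.
  move=> F'p; rewrite strand_sum (eq_bigr (fun b => (b == a)%:R * psi b F')).
    have [as_|as_] := boolP (a \in s).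
      rewrite (bigD1_seq a) ?mem_undup ?undup_uniq //= eqxx big1 ?addr0 // => b ba.
      by rewrite (negPf ba) mul0r.
    rewrite big_seq big1 ?mul0r // => b; rewrite mem_undup => bs.
    by case: eqP => [ba|_]; [rewrite -ba bs in as_ | rewrite mul0r].
  by move=> b _; rewrite strand_mono //; case: (psiP b).
rewrite (codiff_eq (psi := fun F => (a \in s)%:R * psi a F)) => [|i iF]; last first.
  by apply: vE; have := cardsD1 i F; rewrite iF Fp add1n => -[->].
have [as_|as_] := boolP (a \in s).
  by rewrite psiE //; apply: codiff_eq => i _; rewrite mul1r.
have -> : strand u a F = 0 by apply/eqP; apply: contraNT as_; apply: sP.
by rewrite [RHS]big1 // => i _; rewrite mul0r mulr0.
Qed.

Lemma coboundary_strand p (u : cech p) a : coboundary u ->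
  exists2 psi, supported (live e a) psi &
     forall F, live e a F -> #|F| = p -> strand u a F = codiff psi F.
Proof.
case: p u => [|p] u /=.
  move=> ->; exists (fun=> 0) => // F _ _; rewrite strand0 /codiff big1 // => i _.
  by rewrite mulr0.
move=> [v ->]; exists (strand v a); first exact: strand_supported.
by move=> F lv Fp; rewrite strand_diff.
Qed.

End CechStrands.

(** * Length of subquotients *)

Section SubquotientLength.
Variables (R : comNzRingType) (V : lmodType R) (Z : submodClosed V).
Variable (B : submodClosed (submod Z)).

Lemma submod_valZ a (y : submod Z) : val (a *: y) = a *: val y.
Proof. by rewrite -[a *: y]addr0 linearP raddf0 addr0. Qed.

Lemma submod_valB (y z : submod Z) : val (y - z) = val y - val z.
Proof. exact: raddfB. Qed.

Lemma pi_quotmod0 (y : submod Z) : y \in B -> \pi_(quotmod B) y = 0.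
Proof.
move=> yB; have -> : 0 = \pi_(quotmod B) 0.
  by rewrite -(scale0r (\pi_(quotmod B) y)) [LHS]pi_quotmod_scale scale0r.
by apply/eqP; rewrite -Quotient.idealrBE subr0.
Qed.

Lemma pi_quotmodZ a (y : submod Z) : \pi_(quotmod B) (a *: y) = a *: \pi_(quotmod B) y.
Proof. by rewrite [RHS]pi_quotmod_scale. Qed.

(** A strict chain with more steps than functionals yields representatives [y j] with a nontrivial
    [k]-linear combination killed by all functionals, hence lying in [B]; solving for its last term
    contradicts strictness. *)
Lemma finite_length_functionals (k : fieldType) (iota : {rmorphism k -> R})
    (T : finType) (f : T -> V -> k) :
  (forall t, {morph f t : u v / u + v}) ->
  (forall t c u, f t (iota c *: u) = c * f t u) ->
  (forall y : submod Z, (forall t, f t (val y) = 0) -> y \in B) ->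
  finite_length (quotmod B).
Proof.
move=> fD fZ fB; exists #|T| => c N Nlt; rewrite leqNgt; apply/negP => ltTc.
have f0 t : f t 0 = 0 by apply: (addrI (f t 0)); rewrite -fD !addr0.
have Nle i j : (i <= j)%N -> (j <= c)%N -> {subset N i <= N j}.
  move=> /subnK <-; elim: (j - i)%N => [|d IH] le z zN; first by [].
  by have [+ _] := Nlt (d + i)%N le; apply; apply: IH => //; apply: ltnW.
have /choice[y yP] (j : 'I_c) : exists y : submod Z,
    \pi_(quotmod B) y \in N j.+1 /\ \pi_(quotmod B) y \notin N j.
  have [_ nsub] := Nlt j (ltn_ord j).
  have [z [z1 z2]] : exists z, z \in N j.+1 /\ z \notin N j.
    apply: contra_notP nsub => nex z zN; apply: contra_notT nex => nz; by exists z.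
  by exists (repr z); rewrite reprK.
pose D := \matrix_(j < c, q < #|T|) f (enum_val q) (val (y j)).
have [v v0 vD] : exists2 v : 'rV_c, v != 0 & v *m D = 0.
  exists (nz_row (kermx D)); last by apply/sub_kermxP/nz_row_sub.
  rewrite nz_row_eq0 -mxrank_eq0 mxrank_ker -lt0n subn_gt0.
  by apply: leq_ltn_trans (rank_leq_col D) ltTc.
pose Y := \sum_j iota (v 0 j) *: y j.
have YB : \pi_(quotmod B) Y = 0.
  apply/pi_quotmod0/fB => t.
  have -> : val Y = \sum_j iota (v 0 j) *: val (y j).
    by rewrite raddf_sum; apply: eq_bigr => j _; apply: submod_valZ.
  rewrite (big_morph (f t) (fD t) (f0 t)).
  have /rowP/(_ (enum_rank t)) := vD; rewrite !mxE => vDt; apply: etrans vDt.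
  by apply: eq_bigr => j _; rewrite fZ !mxE enum_rankK.
have [j0 vj0] : exists j, v 0 j != 0.
  by apply/existsP; apply: contraR v0 => /existsPn h; apply/eqP/rowP => j; rewrite mxE; apply/eqP/negPn/h.
(* For the largest index in the relation, [y j] becomes modulo [B] a combination of earlier [y i],
   whose classes lie in [N j]. *)
have [j vj jmax] := @arg_maxnP _ j0 (fun j => v 0 j != 0) (fun j : 'I_c => val j) vj0.
have [_ /negP] := yP j; apply.
pose w := y j - iota (v 0 j)^-1 *: Y.
have -> : \pi_(quotmod B) (y j) = \pi_(quotmod B) w.
  have : \pi_(quotmod B) (w + iota (v 0 j)^-1 *: Y) =
         \pi_(quotmod B) w + iota (v 0 j)^-1 *: \pi_(quotmod B) Y.
    by rewrite pi_quotmodD pi_quotmodZ.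
  by rewrite YB scaler0 addr0 subrK.
have -> : w = \sum_(i < c | i != j) iota (- (v 0 i / v 0 j)) *: y i.
  rewrite /w /Y (bigD1 j) //= scalerDr scalerA -rmorphM mulVf // rmorph1 scale1r.
  rewrite opprD addNKr scaler_sumr -sumrN; apply: eq_bigr => i _.
  by rewrite scalerA -rmorphM -scaleNr -rmorphN mulrC.
apply: (big_ind (fun z => \pi_(quotmod B) z \in N j)).
- by rewrite pi_quotmod0 ?rpred0.
- by move=> z1 z2 h1 h2; rewrite pi_quotmodD rpredD.
move=> i ij; rewrite pi_quotmodZ; have [->|vi] := eqVneq (v 0 i) 0.
  by rewrite mul0r oppr0 rmorph0 scale0r rpred0.
apply: rpredZ; have [yi _] := yP i; apply: Nle yi; last exact: ltnW.
by rewrite ltn_neqAle ij; apply: jmax.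
Qed.

(** The images of the [P j] in the quotient form a strictly increasing chain without end. *)
Lemma infinite_length_filtration (P : nat -> submodClosed V) :
  (forall j, {subset P j <= P j.+1}) ->
  (forall j, exists2 y : submod Z, val y \in P j.+1 &
     forall y' : submod Z, val y' \in P j -> y - y' \notin B) ->
  ~ finite_length (quotmod B).
Proof.
move=> Pmono ex_y [l fl].
pose N j : {pred quotmod B} := fun z =>
  `[< exists2 y : submod Z, z = \pi_(quotmod B) y & val y \in P j >].
have Nsub j : submod_closed (N j).
  split; first by apply/asboolP; exists 0; rewrite ?pi_quotmod0 ?rpred0.
  move=> a z1 z2 /asboolP[y1 -> P1] /asboolP[y2 -> P2]; apply/asboolP.
  exists (a *: y1 + y2); first by rewrite pi_quotmodD pi_quotmodZ.
  by rewrite linearP /= rpredD ?rpredZ.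
pose Nj j : submodClosed (quotmod B) :=
  HB.pack (N j) (GRing.isSubmodClosed.Build _ _ (N j) (Nsub j)).
suff /(fl l.+1) : forall j, (j < l.+1)%N -> strict_sub (Nj j) (Nj j.+1) by rewrite ltnn.
move=> j _; split.
  by move=> z /asboolP[y -> yP]; apply/asboolP; exists y => //; apply: Pmono.
have [y yP ny] := ex_y j => sub.
have : \pi_(quotmod B) y \in Nj j.+1 by apply/asboolP; exists y.
move=> /sub/asboolP[y' yy' y'P]; have /negP := ny y' y'P; apply.
by move/eqP: yy'; rewrite -Quotient.idealrBE.
Qed.

End SubquotientLength.

(** * Length of local cohomology *)

Section LocalCohomologyLength.
Variables (k : fieldType) (n : nat) (e : rel 'I_n).
Implicit Types (F : {set 'I_n}) (a b : {ffun 'I_n -> int}) (m : 'X_{1..n}) (p : nat).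

Local Notation S := {mpoly k[n]}.
Local Notation M := (quotmod (symbolic_square k e)).
Local Notation x := (fun i : 'I_n => 'X_i : S).
Local Notation cech := (cech x M).

(** The functionals are the coefficients [strand u a F] with [a] in [A]. If all vanish on a cocycle,
    its strands in [A] are zero and the others are exact. *)
Lemma finite_length_strands p (A : seq {ffun 'I_n -> int}) :
  (forall a, a \notin A -> strand_acyclic k (live e a) p) ->
  finite_length (local_cohomology x M p).
Proof.
move=> acA.
apply: (@finite_length_functionals _ _ _ _ k (@mpolyC n k) ('I_(size A) * {set 'I_n})%type
  (fun t u => strand u (tnth (in_tuple A) t.1) t.2)).
- by move=> t u v; apply: strandD.
- by move=> t c u; apply: strandCZ.
move=> y y0; apply/asboolP/coboundary_strands => a.
have [aA|aA] := boolP (a \in A); last first.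
  apply: acA => //; first exact: strand_supported.
  by move=> F lv Fp; rewrite -strand_diff // (eqP (valP y)) strand0.
exists (fun=> 0) => // F lv Fp; rewrite [RHS]big1 => [|i _]; last by rewrite mulr0.
have := y0 (Ordinal (etrans (index_mem a A) aA), F).
by rewrite /= (tnth_nth a) /= nth_index.
Qed.

(** Cochains with poles of order at most [j] in the variable [v]; multiplication by polynomials
    cannot increase this order. *)
Definition pole_bounded p (v : 'I_n) (j : nat) : {pred cech p} := fun u =>
  `[< forall a F, a v < - j%:Z -> strand u a F = 0 >].

Lemma pole_bounded_submod p v j : submod_closed (@pole_bounded p v j).
Proof.
split; first by apply/asboolP => a F _; apply: strand0.
move=> r u w /asboolP hu /asboolP hw; apply/asboolP => a F av.
rewrite strandD hw // addr0 [r]mpolyE scaler_suml strand_sum big1 // => m _.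
rewrite -mul_mpolyC -scalerA strandCZ strandXZ; case: ifP => _; last by rewrite mulr0.
by rewrite hu ?mulr0 // ffunE; lia.
Qed.

(** A nontrivial class in degree [a_ j] has a pole of order [j + 1] at [v]. Coboundaries split by
    degree, so it is not congruent to any cocycle with smaller poles, and the filtration by pole
    order never stabilizes. *)
Lemma infinite_length_poles p v (a_ : nat -> {ffun 'I_n -> int}) :
  (forall j, a_ j v = - j.+1%:Z) ->
  (forall j, ~ strand_acyclic k (live e (a_ j)) p) ->
  ~ finite_length (local_cohomology x M p).
Proof.
move=> av nac.
pose P j : submodClosed (cech p) := HB.pack (@pole_bounded p v j)
  (GRing.isSubmodClosed.Build _ _ (@pole_bounded p v j) (@pole_bounded_submod p v j)).
apply: (@infinite_length_filtration _ _ _ _ P).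
  move=> j u /asboolP uj; apply/asboolP => a F lt; apply: uj; lia.
move=> j; apply: contra_notP (nac j) => ny phi phiL dphi.
have ycoc : cech_mono e p phi (a_ j) \in @cocycle _ _ x M p.
  apply/eqP/esym/strand_diff_eq => b F lv Fp; rewrite strand0.
  rewrite (codiff_eq (psi := fun F => (a_ j == b)%:R * phi F)) => [|i iF]; last first.
    by rewrite strand_mono //; have := cardsD1 i F; rewrite iF Fp add1n => -[->].
  have [ab|_] := eqVneq (a_ j) b; last by rewrite [RHS]big1 // => i _; rewrite mul0r mulr0.
  by rewrite (codiff_eq (psi := phi)) ?dphi ?ab // => i _; rewrite mul1r.
apply: contra_notP ny => npsi; exists (Submod ycoc).
  apply/asboolP => b F lt; have [/eqP Fp|Fp] := boolP (#|F| == p); last exact: strand_card.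
  rewrite strand_mono //; case: eqP => [ab|_]; last by rewrite mul0r.
  by move: lt; rewrite -ab av; lia.
move=> y' /asboolP y'P; apply/negP => /asboolP; rewrite submod_valB => /(coboundary_strand (a_ j)).
move=> [psi psiL psiE]; apply: npsi; exists psi => // F lv Fp; rewrite -psiE //.
rewrite strandB [X in _ - X]y'P ?av; last by lia.
by rewrite subr0 strand_mono // eqxx mul1r.
Qed.

End LocalCohomologyLength.

(** * Krull dimension *)

Section KrullDimension.
Variables (k : fieldType) (n : nat).
Local Notation S := {mpoly k[n]}.
Implicit Types (A F : {set 'I_n}) (p q : S) (m : 'X_{1..n}) (P : nat -> prime_idealr S).

(** * Primes as kernels of maps to a domain *)

Section KernelPrime.
Variables (R : comNzRingType) (D : idomainType) (f : {rmorphism R -> D}).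

Definition kernel_ideal : {pred R} := fun r => f r == 0.

Lemma mem_kernel_ideal r : (r \in kernel_ideal) = (f r == 0).
Proof. by []. Qed.

Lemma kernel_ideal_closed : idealr_closed kernel_ideal.
Proof.
split; first by rewrite unfold_in rmorph0.
  by rewrite unfold_in rmorph1 oner_eq0.
move=> a u v; rewrite !unfold_in => /eqP fu /eqP fv.
by rewrite rmorphD rmorphM fu fv mulr0 addr0.
Qed.

Lemma kernel_ideal_prime : prime_idealr_closed kernel_ideal.
Proof. by move=> u v; rewrite !unfold_in rmorphM mulf_eq0. Qed.

HB.instance Definition _ := isIdealr.Build R kernel_ideal kernel_ideal_closed.
HB.instance Definition _ := isPrimeIdealrClosed.Build R kernel_ideal kernel_ideal_prime.
End KernelPrime.

(** Sets the variables outside [A] to 0; the kernel is the prime they generate. *)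
Definition kill A : S -> S := comp_mpoly [tuple (if i \in A then 'X_i else 0) | i < n].
HB.instance Definition _ A := GRing.RMorphism.on (kill A).

Lemma killX A m : kill A 'X_[m] = if [forall i in ~: A, m i == 0%N] then 'X_[m] else 0.
Proof.
rewrite /kill comp_mpolyX; case: ifP => [/forallP m0|].
  rewrite [RHS]mpolyXE_id; apply: eq_bigr => i _; rewrite tnth_mktuple.
  by case: ifPn => // iA; have := m0 i; rewrite inE iA /= => /eqP->; rewrite !expr0.
move/forallPn => [i]; rewrite negb_imply inE => /andP[iA mi].
rewrite (bigD1 i) //= tnth_mktuple (negPf iA) expr0n (negPf mi).
by rewrite mul0r.
Qed.

Lemma killZ A c p : kill A (c *: p) = c *: kill A p.
Proof. exact: comp_mpolyZ. Qed.

Lemma sub_kill_in A p (Q : prime_idealr S) :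
  (forall i, i \notin A -> 'X_i \in Q) -> p - kill A p \in Q.
Proof.
move=> XQ; rewrite {1 2}[p]mpolyE rmorph_sum /= -sumrB; apply: rpred_sum => m _.
rewrite killZ -scalerBr -mul_mpolyC idealMr // killX.
case: ifP => [_|/forallPn[i]]; first by rewrite subrr rpred0.
rewrite negb_imply inE subr0 => /andP[iA mi].
have -> : m = (m - U_(i) + U_(i))%MM.
  by rewrite submK //; apply/mnm_lepP => j; rewrite mnm1E; case: eqP => [<-|//]; rewrite lt0n.
by rewrite mpolyXD idealMr ?XQ.
Qed.

(* Polynomials of degree < N in each of m variables are encoded by their
   coefficients, indexed by sequences of m exponents. *)
Fixpoint grid_eval (N m : nat) (lam : seq nat -> k) (y : nat -> S) : S :=
  if m is m'.+1 then
    \sum_(c < N) y 0%N ^+ c * grid_eval N m' (fun s => lam (val c :: s)) (y \o succn)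
  else (lam [::])%:MP.
Definition grid_ok N d (s : seq nat) := (size s == d) && all (ltn^~ N) s.

Lemma grid_eval0 N d lam y : (forall s, grid_ok N d s -> lam s = 0) -> grid_eval N d lam y = 0.
Proof.
elim: d lam y => [|d IH] lam y lam0 /=; first by rewrite lam0 // mpolyC0.
rewrite big1 // => c _; rewrite IH ?mulr0 // => s /andP[/eqP sd sN].
by apply: lam0; rewrite /grid_ok /= sd eqxx ltn_ord sN.
Qed.

Lemma grid_eval_sum N d (I : finType) (v : I -> k) (g : I -> seq nat -> k) y :
  grid_eval N d (fun s => \sum_t v t * g t s) y = \sum_t v t *: grid_eval N d (g t) y.
Proof.
elim: d g y => [|d IH] g y /=.
  by rewrite rmorph_sum; apply: eq_bigr => t _; rewrite rmorphM mul_mpolyC.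
under eq_bigr => c _ do rewrite IH mulr_sumr.
rewrite exchange_big; apply: eq_bigr => t _; rewrite scaler_sumr.
by apply: eq_bigr => c _; rewrite scalerAr.
Qed.

(* Coquand-Lombardi: factoring out the lowest power of y 0 shows that a nonzero
   polynomial expression in y cannot vanish when y j is in P (j+1) but not in P j. *)
Lemma grid_eval_notin N d lam y P :
  (forall j, (j < d)%N -> [/\ {subset P j <= P j.+1}, y j \in P j.+1 & y j \notin P j]) ->
  (exists2 s, grid_ok N d s & lam s != 0) -> grid_eval N d lam y \notin P 0%N.
Proof.
elim: d lam y P => [|d IH] lam y P yP [s sok lams] /=.
  move: sok lams; rewrite /grid_ok; case: s => //= _ lam0.
  apply/negP => /(idealMr (lam [::])^-1%:MP); rewrite -mpolyCM mulVf // mpolyC1.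
  by rewrite idealr1.
pose Q c := `[< exists2 s, grid_ok N d s & lam (c :: s) != 0 >].
have exQ : exists c, Q c && (c < N)%N.
  case: s sok lams => [|c s] //; rewrite /grid_ok /= eqSS => /and3P[sd cN sN] lams.
  by exists c; rewrite cN andbT; apply/asboolP; exists s => //; rewrite /grid_ok sd.
have [c0 /andP[/asboolP Qc0 c0N] cmin] := ex_minnP exQ.
have [P01 y01 y00] := yP 0%N isT.
pose E c := grid_eval N d (fun s => lam (c :: s)) (y \o succn).
have E0 c : (c < c0)%N -> E c = 0.
  move=> cc; apply: grid_eval0 => s' s'ok; apply/eqP/negPn/negP => lams'.
  suff : (c0 <= c)%N by rewrite leqNgt cc.
  apply: cmin; rewrite (ltn_trans cc c0N) andbT.
  by apply/asboolP; exists s'.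
have -> : \sum_(c < N) y 0%N ^+ c * E c = y 0%N ^+ c0 * \sum_(c < N) y 0%N ^+ (c - c0) * E c.
  rewrite mulr_sumr; apply: eq_bigr => c _; rewrite mulrA -exprD.
  by have [cc|cc] := ltnP c c0; [rewrite E0 // !mulr0 | rewrite subnKC].
rewrite prime_idealrM negb_or; apply/andP; split.
  elim: (c0) => [|c IHc]; first by rewrite expr0 idealr1.
  by rewrite exprS prime_idealrM negb_or y00.
have Ec0 : E c0 \notin P 1%N.
  apply: (IH _ _ (P \o succn)) => [j jd|]; first exact: yP.
  by case: Qc0 => s' s'ok ls'; exists s'.
apply: contra Ec0 => /P01.
(* Modulo [P 1] only the term at [c0] remains: lower ones vanish and higher ones contain the factor
   [y 0]. *)
rewrite (bigD1 (Ordinal c0N)) //= subnn expr0 mul1r rpredDr //.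
apply: rpred_sum => c; rewrite -val_eqE /= neq_ltn => /orP[cc|cc].
  by rewrite E0 // mulr0 rpred0.
rewrite -(prednK (_ : 0 < c - c0)%N) ?subn_gt0 // exprS -mulrA mulrC.
exact: idealMr.
Qed.

(** * Algebraic dependence by counting exponents *)

Definition exps_in F B p := forall m i, p@_m != 0 -> (m i <= (i \in F) * B)%N.

Lemma exps_in_kill F p : exps_in F (msize p) (kill F p).
Proof.
move=> m i; rewrite {1}[p]mpolyE rmorph_sum raddf_sum /= => nz.
have [m' m'p] : exists2 m', m' \in msupp p & (kill F (p@_m' *: 'X_[m']))@_m != 0.
  apply: contraNP nz => nex; rewrite big_seq big1 // => m' m'p.
  by apply: contra_notP nex => /eqP h; exists m'.
rewrite killZ killX mcoeffZ; case: ifP => [/forallP m'0|]; last by rewrite mcoeff0 mulr0 eqxx.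
rewrite mcoeffX; have [<- _|_] := eqVneq m' m; last by rewrite mulr0 eqxx.
have [iF|iF] := boolP (i \in F); last by have := m'0 i; rewrite inE iF /= => /eqP->.
rewrite mul1n; apply: leq_trans (ltnW (msize_mdeg_lt m'p)).
by rewrite mdegE (bigD1 i) //= leq_addr.
Qed.

Lemma exps_inM F B1 B2 p q : exps_in F B1 p -> exps_in F B2 q -> exps_in F (B1 + B2) (p * q).
Proof.
move=> hp hq m i; rewrite mcoeffM => nz.
have [[m1 m2] /= /eqP mE] : exists2 t : 'X_{1..n < (mdeg m).+1, (mdeg m).+1},
    (m == (t.1 + t.2)%MM) & p@_(t.1) * q@_(t.2) != 0.
  apply: contraNP nz => nex; rewrite big1 // => t tm.
  by apply: contra_notP nex => /eqP h; exists t.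
rewrite mulf_eq0 negb_or => /andP[/(hp _ i) h1 /(hq _ i) h2].
by rewrite mE mnmDE mulnDr leq_add.
Qed.

Lemma exps_in_sum F B (I : finType) (f : I -> S) :
  (forall i, exps_in F B (f i)) -> exps_in F B (\sum_i f i).
Proof.
move=> hf m i; rewrite raddf_sum => /= nz.
have [j fj] : exists j, (f j)@_m != 0.
  apply: contraNP nz => nex; rewrite big1 // => j _.
  by apply: contra_notP nex => /eqP h; exists j.
exact: hf fj.
Qed.

Lemma exps_inC F B c : exps_in F B c%:MP.
Proof. by move=> m i; rewrite mcoeffC; have [->|_] := eqVneq m 0%MM; rewrite ?mnm0E // mulr0 eqxx. Qed.

Lemma exps_inW F B1 B2 p : (B1 <= B2)%N -> exps_in F B1 p -> exps_in F B2 p.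
Proof. by move=> le h m i /(h _ i) le1; apply: leq_trans le1 _; rewrite leq_mul2l le orbT. Qed.

Lemma exps_inXn F B p c : exps_in F B p -> exps_in F (c * B) (p ^+ c).
Proof.
move=> hp; elim: c => [|c IH]; first by rewrite expr0 -mpolyC1; apply: exps_inC.
by rewrite exprS mulSn; apply: exps_inM.
Qed.

Lemma exps_in_grid_eval F B N d lam y : (forall j, (j < d)%N -> exps_in F B (y j)) ->
  exps_in F (d * (N * B)) (grid_eval N d lam y).
Proof.
elim: d lam y => [|d IH] lam y hy /=; first exact: exps_inC.
apply: exps_in_sum => c; rewrite mulSn; apply: exps_inM; last by apply: IH => j jd; apply: (hy j.+1).
by apply: (@exps_inW _ (c * B)); [rewrite leq_mul2r ltnW ?orbT | apply/exps_inXn/(hy 0%N)].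
Qed.

(** There are [N ^ d] power products of the [y j], and their expansions use at most [C.+1 ^ #|F|]
    exponents, which is fewer for large [N]; so some linear relation holds. *)
Lemma grid_eval_dependent F B (d := #|F|.+1) (y : nat -> S) :
  (forall j, (j < d)%N -> exps_in F B (y j)) ->
  exists N lam, (exists2 s, grid_ok N d s & lam s != 0) /\ grid_eval N d lam y = 0.
Proof.
(* Exponents in the expansions are at most [C], and [C.+1 <= N * K]. Since [N] exceeds [K ^ #|F|],
   it follows that [(N * K) ^ #|F| < N ^ d]. *)
move=> hy; pose K := (d * B).+1; pose N := (K ^ #|F|).+1.
pose C := (d * (N * B))%N; pose Q := pffun_on (ord0 : 'I_C.+1) F predT.
pose T := d.-tuple 'I_N; pose delta (t : T) (s : seq nat) : k := (map val t == s)%:R.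
pose D := \matrix_(i < #|{: T}|, j < #|Q|)
  (grid_eval N d (delta (enum_val i)) y)@_[multinom val (enum_val j l) | l < n].
have ltQT : (#|Q| < #|{: T}|)%N.
  rewrite card_pffun_on card_tuple !card_ord expnS.
  apply: (@leq_ltn_trans ((N * K) ^ #|F|)).
    have le : (C.+1 <= N * K)%N by rewrite /C /K mulnS mulnCA -addn1 addnC leq_add.
    by case: #|F| => [|r] //; rewrite leq_exp2r.
  by rewrite expnMn mulnC ltn_pmul2r ?expn_gt0.
have [v v0 vD] : exists2 v : 'rV_#|{: T}|, v != 0 & v *m D = 0.
  exists (nz_row (kermx D)); last by apply/sub_kermxP/nz_row_sub.
  rewrite nz_row_eq0 -mxrank_eq0 mxrank_ker -lt0n subn_gt0.
  by apply: leq_ltn_trans (rank_leq_col D) ltQT.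
exists N, (fun s => \sum_i v 0 i * delta (enum_val i) s); split.
  have [i vi] : exists i, v 0 i != 0.
    apply/existsP; apply: contraR v0 => /existsPn h.
    by apply/eqP/rowP => i; rewrite mxE; apply/eqP/negPn/h.
  exists (map val (enum_val i)).
    rewrite /grid_ok size_map size_tuple eqxx; apply/allP => c /mapP[c' _ ->].
    exact: ltn_ord.
  rewrite (bigD1 i) //= {1}/delta eqxx mulr1 big1 ?addr0 // => j ji.
  rewrite /delta (inj_eq (inj_map val_inj)) (inj_eq val_inj) (inj_eq enum_val_inj).
  by rewrite (negPf ji) mulr0.
rewrite grid_eval_sum; apply/mpolyP => m; rewrite mcoeff0 raddf_sum /=.
have [mQ|] := boolP [forall i, m i <= (i \in F) * C]%N; last first.
  move=> /forallPn[i im]; rewrite big1 // => t _; rewrite mcoeffZ.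
  apply/eqP; rewrite mulf_eq0; apply/orP; right; apply: contraR im; exact: (exps_in_grid_eval hy).
have le i := forallP mQ i.
have leC i : (m i < C.+1)%N.
  by rewrite ltnS (leq_trans (le i)) // -{2}[C]mul1n leq_mul2r leq_b1 orbT.
pose f := [ffun i => Ordinal (leC i)].
have fQ : f \in Q.
  apply/pffun_onP; split=> //; apply/subsetP => i; rewrite !inE ffunE -val_eqE /=.
  by apply: contraR => iF; have := le i; rewrite (negPf iF) leqn0.
have /rowP/(_ (enum_rank_in fQ f)) := vD; rewrite !mxE => vDf; apply: etrans vDf.
apply: eq_bigr => t _; rewrite mcoeffZ mxE; congr (_ * _@__).
by apply/mnmP => i; rewrite mnmE enum_rankK_in // ffunE.
Qed.

(** Choose [y j] in [P j.+1] outside [P j]; modulo [P 0] they become polynomials in the variables of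
    [F]. If [d > #|F|], the first [#|F|.+1] of them are algebraically dependent, against
    [grid_eval_notin]. *)
Lemma prime_chain_le F d P :
  (forall i, i \notin F -> 'X_i \in P 0%N) ->
  (forall j, (j < d)%N -> strict_sub (P j) (P j.+1)) -> (d <= #|F|)%N.
Proof.
move=> XP chP; rewrite leqNgt; apply/negP => lt.
have /choice[y yP] j : exists y : S, (j < d)%N -> y \in P j.+1 /\ y \notin P j.
  have [jd|_] := boolP (j < d)%N; last by exists 0.
  have [_ nsub] := chP j jd; apply: contra_notP nsub => nex z zP.
  by apply: contra_notT nex => nz; exists z.
have P0 j : (j <= d)%N -> {subset P 0%N <= P j}.
  elim: j => [|j IH] jd z zP //; have [+ _] := chP j jd; apply.
  by apply: IH => //; apply: ltnW.
have killP j l : (j <= d)%N -> (kill F (y l) \in P j) = (y l \in P j).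
  move=> jd; have dP : y l - kill F (y l) \in P j.
    by apply: (P0 j jd); apply: sub_kill_in.
  by rewrite -[in RHS](subrK (kill F (y l)) (y l)) rpredDl.
pose B := (\sum_(j < #|F|.+1) msize (y j))%N.
have [|N [lam [ex_s eval0]]] := @grid_eval_dependent F B (fun j => kill F (y j)).
  move=> j jd; apply: (exps_inW _ (exps_in_kill (p := y j))).
  by rewrite /B (bigD1 (Ordinal jd)) //= leq_addr.
have /negP[] : grid_eval N #|F|.+1 lam (fun j => kill F (y j)) \notin P 0%N; last first.
  by rewrite eval0 rpred0.
apply: grid_eval_notin ex_s => j jF; have jd : (j < d)%N by apply: leq_trans jF lt.
have [y1 y0] := yP j jd; have [P01 _] := chP j jd.
by rewrite !killP // ltnW.
Qed.

Section DimensionOfSymbolicSquare.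
Variable e : rel 'I_n.
Local Notation M := (quotmod (symbolic_square k e)).

Lemma facet_exists A : independent e A -> exists2 F, facet e F & A \subset F.
Proof. by move=> /maxset_exists[F Fm AF]; exists F. Qed.

Lemma ann_symbolic_square (r : S) :
  (forall u : M, r *: u = 0) <-> r \in symbolic_square k e.
Proof.
have pi0 : \pi_M 0 = 0 by rewrite -(scale0r (\pi_M 0)) pi_quotZ mul0r.
split=> [/(_ (\pi_M 1))|rJ u].
  by rewrite pi_quotZ mulr1 -pi0 => /eqP; rewrite pi_quotmod_eq subr0.
elim/quotmod_ind: u => p; rewrite pi_quotZ -pi0; apply/eqP; rewrite pi_quotmod_eq subr0.
by rewrite mulrC; apply: (@rpredZ _ {mpoly k[n]}^o).
Qed.

(** The chain starts with the prime of the variables outside [F] and then adds those of [F] one at a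
    time. *)
Lemma lt_dim_facet F i : facet e F -> (i < #|F|)%N -> lt_dim i M.
Proof.
move=> Fm iF; pose A j := [set v in drop j (enum F)].
exists (fun j => (kernel_ideal (kill (A j)) : prime_idealr S)); split=> [r|j ji].
  move=> /ann_symbolic_square/symbolic_squareP rJ; rewrite mem_kernel_ideal /A drop0 set_enum.
  rewrite [r]mpolyE rmorph_sum /= big1 // => m _; rewrite killZ killX.
  case: ifP => [/forallP m0|]; last by rewrite scaler0.
  rewrite rJ ?scale0r //; apply/existsP; exists F; rewrite Fm /codeg big1 // => v vF.
  by have := m0 v; rewrite inE vF => /eqP.
have killU B v : kill B 'X_v = if v \in B then 'X_v else 0.
  by rewrite /kill comp_mpolyXU -tnth_nth tnth_mktuple.
have jF : (j < size (enum F))%N by rewrite -cardE (leq_ltn_trans ji).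
have [v Aj] : exists v, drop j (enum F) = v :: drop j.+1 (enum F).
  by case: (enum F) jF => // u s; exists (nth u (u :: s) j); apply: drop_nth.
have vA : v \in A j by rewrite inE Aj mem_head.
have vA1 : v \notin A j.+1.
  by have := drop_uniq j (enum_uniq F); rewrite Aj inE /= => /andP[].
split=> [p|sub].
  move=> pA; have kp : kill (A j) p = 0 by apply/eqP.
  suff : p - kill (A j) p \in kernel_ideal (kill (A j.+1)) by rewrite kp subr0.
  apply: sub_kill_in => u uA.
  rewrite mem_kernel_ideal /= killU ifN //; apply: contra uA.
  by rewrite !inE Aj inE => ->; rewrite orbT.
have /sub : 'X_v \in kernel_ideal (kill (A j.+1)) by rewrite mem_kernel_ideal /= killU (negPf vA1).
by rewrite mem_kernel_ideal /= killU vA => /eqP/(congr1 (mcoeff U_(v)))/eqP; rewrite mcoeffX eqxx mcoeff0 oner_eq0.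
Qed.

(** The variables outside [P 0] form an independent set, because the square of an edge monomial lies
    in the symbolic square. A maximal independent set containing them bounds the chain. *)
Lemma facet_lt_dim i : lt_dim i M -> exists2 F, facet e F & (i < #|F|)%N.
Proof.
move=> [P [annP chP]].
have JP p : p \in symbolic_square k e -> p \in P 0%N.
  by move=> /ann_symbolic_square/annP.
pose A := [set v | 'X_v \notin P 0%N].
have Aind : independent e A.
  apply/forall_inP => u uA; apply/forall_inP => v vA; apply/negP => euv.
  have : ('X_u * 'X_v : S) ^+ 2 \in P 0%N.
    apply: JP; apply/symbolic_squareP => m /existsP[F /andP[Fm lt2]].
    rewrite -mpolyXD mpolyXn mcoeffX; case: eqP => // mE; move: lt2; rewrite -{}mE.
    have uvF : (u \notin F) || (v \notin F).
      rewrite -negb_and; apply: contraL euv => /andP[uF vF].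
      by have /forall_inP/(_ u uF)/forall_inP/(_ v vF) := maxsetp Fm.
    have le w : w \notin F -> (w == u) || (w == v) -> (2 <= codeg F ((U_(u) + U_(v)) *+ 2))%N.
      move=> wF wuv; rewrite /codeg (bigD1 w) //= mulmnE mnmDE !mnm1E ![_ == w]eq_sym.
      by case/orP: wuv => ->; lia.
    case/orP: uvF => /le; rewrite eqxx ?orbT => /(_ isT); rewrite leqNgt => /negP nlt /nlt //.
  rewrite expr2 !prime_idealrM !orbb => /orP[] h; [move: uA | move: vA]; by rewrite inE h.
have [F Fm AF] := facet_exists Aind; exists F => //.
apply: (@prime_chain_le F i.+1 P) => // v vF.
by apply: contraNT vF => vP; apply: (subsetP AF); rewrite inE.
Qed.

End DimensionOfSymbolicSquare.
End KrullDimension.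

(** * Non-acyclic strands *)

Section Necessity.
Variables (k : fieldType) (n : nat) (e : rel 'I_n).
Hypotheses (e_sym : ssrbool.symmetric e) (e_irr : irreflexive e).
Implicit Types (F T : {set 'I_n}) (a : {ffun 'I_n -> int}).

Lemma independentP F : reflect (forall i j, i \in F -> j \in F -> ~~ e i j) (independent e F).
Proof.
apply: (iffP forall_inP) => [h i j iF jF|h i iF]; first by have /forall_inP := h i iF; apply.
by apply/forall_inP => j jF; apply: h.
Qed.

Lemma independentS F T : F \subset T -> independent e T -> independent e F.
Proof.
move=> /subsetP FT /independentP h; apply/independentP => i j iF jF.
by apply: h; apply: FT.
Qed.

Lemma independentU1 F v : independent e F -> (forall j, j \in F -> ~~ e v j) ->
  independent e (v |: F).
Proof.
move=> /independentP Find vF; apply/independentP => i j.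
rewrite !inE => /orP[/eqP->|iF] /orP[/eqP->|jF]; first by rewrite e_irr.
- exact: vF.
- by rewrite e_sym; apply: vF.
exact: Find.
Qed.

Lemma facetP F : reflect (independent e F /\
    forall v, v \notin F -> exists2 u, u \in F & e v u) (facet e F).
Proof.
apply: (iffP maxsetP) => [[Find Fmax]|[Find Fmax]]; split=> //.
  move=> v vF; apply/exists_inP; apply: contraR vF => /exists_inPn h.
  by rewrite -(Fmax (v |: F)) ?setU11 ?subsetUr // independentU1.
move=> T Tind FT; apply/eqP; rewrite eqEsubset FT andbT; apply/subsetP => v vT.
apply/negPn/negP => /Fmax[u uF]; apply/negP.
by move/independentP: Tind; apply => //; apply: (subsetP FT).
Qed.

Lemma facet_subset_eq F T : facet e F -> facet e T -> F \subset T -> F = T.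
Proof. by move=> /maxsetP[_ Fmax] /maxsetP[Tind _] FT; rewrite (Fmax T). Qed.

Lemma liveP a F : reflect ((forall i, a i < 0 -> i \in F) /\
    exists F', [/\ facet e F', F \subset F' & \sum_(j | j \notin F') a j <= 1])
  (live e a F).
Proof.
apply: (iffP andP) => [[/forallP neg /existsP[F' /and3P[]]]|[neg [F' [h1 h2 h3]]]].
  by split=> [i ai|]; [have /implyP := neg i; apply | exists F'].
split; first by apply/forallP => i; apply/implyP/neg.
by apply/existsP; exists F'; apply/and3P.
Qed.

(** [F] is the only live set, so its indicator is a cocycle and there is no nonzero cochain one
    degree lower. *)
Lemma facet_strand F (c : nat) (a := [ffun i => if i \in F then - c.+1%:Z else 0]) :
  facet e F -> ~ strand_acyclic k (live e a) #|F|.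
Proof.
move=> Fm.
have liveE F' : live e a F' = (F' == F).
  apply/liveP/eqP => [[neg [F1 [F1m F'F1 _]]]|->].
    have FF' : F \subset F' by apply/subsetP => i iF; apply: neg; rewrite ffunE iF.
    apply/eqP; rewrite eqEsubset FF' andbT.
    by rewrite (facet_subset_eq Fm F1m) // (subset_trans FF').
  split=> [i|]; first by rewrite ffunE; case: ifP.
  by exists F; split=> //; rewrite big1 // => j jF; rewrite ffunE (negPf jF).
pose phi F' : k := (F' == F)%:R.
move=> /(_ phi)[F'||psi psiL psiE].
- by rewrite liveE /phi => /negPf->.
- by move=> F'; rewrite liveE => /eqP-> /eqP; rewrite eqn_leq ltnn andbF.
have := psiE F; rewrite liveE eqxx => /(_ isT erefl).
rewrite /phi eqxx [codiff _ _]big1 => [/eqP|i iF]; first by rewrite oner_eq0.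
rewrite psiL ?mulr0 // liveE; apply/eqP => /setP/(_ i).
by rewrite !inE eqxx iF.
Qed.

Lemma sum_notin_pred1 F (u : 'I_n) : (\sum_(j | j \notin F) (j == u) = (u \notin F))%N.
Proof.
have [uF|uF] := boolP (u \in F); last first.
  by rewrite (bigD1 u) //= eqxx big1 ?addn0 // => j /andP[_ /negPf->].
by rewrite big1 // => j; case: eqP => // ->; rewrite uF.
Qed.

(** Live sets contain [T] and stay independent when [u] or when [v] is added; by the condition on
    [T] only [T] itself is of both kinds. The coboundary of the indicator of [T], kept on the [u]
    side only, is thus a cocycle but not a coboundary. *)
Lemma edge_strand (u v : 'I_n) T (c : nat)
    (a := [ffun i => if i \in T then - c.+1%:Z else ((i == u) + (i == v))%N%:Z]) :
  e u v -> independent e (u |: T) -> independent e (v |: T) ->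
  (forall i, i \notin T -> ~~ e i u -> ~~ e i v -> exists2 t, t \in T & e i t) ->
  ~ strand_acyclic k (live e a) #|T|.+1.
Proof.
move=> euv uT vT Tmax.
have uv : u != v by apply: contraTneq euv => ->; rewrite e_irr.
have uNT : u \notin T.
  apply: contraL euv => uT'; move/independentP: vT; apply; by rewrite !inE ?eqxx ?uT' ?orbT.
have vNT : v \notin T.
  apply: contraL euv => vT'; move/independentP: uT; apply; by rewrite !inE ?eqxx ?vT' ?orbT.
have sumE (F : {set 'I_n}) : T \subset F ->
    \sum_(j | j \notin F) a j = ((u \notin F) + (v \notin F))%N%:Z.
  move=> TF; rewrite (eq_bigr (fun j => ((j == u) + (j == v))%N%:Z)) => [|j jF].
    rewrite -(big_morph Posz PoszD (erefl (Posz 0))) big_split /=; congr (Posz (_ + _)).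
      exact: sum_notin_pred1.
    exact: sum_notin_pred1.
  rewrite ffunE; have /negPf-> // : j \notin T by apply: contra jF; apply: (subsetP TF).
have liveE F : live e a F = (T \subset F) && (independent e (u |: F) || independent e (v |: F)).
  apply/liveP/andP => [[neg [F1 [F1m FF1]]]|[TF ind]].
    have TF : T \subset F by apply/subsetP => i iT; apply: neg; rewrite ffunE iT.
    rewrite sumE ?(subset_trans TF) // => le1; split=> //.
    have /orP[uF|vF] : (u \in F1) || (v \in F1).
      by move: le1; case: (u \in F1); case: (v \in F1).
      by apply/orP; left; apply: independentS (maxsetp F1m); rewrite subUset sub1set uF.
    by apply/orP; right; apply: independentS (maxsetp F1m); rewrite subUset sub1set vF.
  split=> [i|]; first by rewrite ffunE; case: ifP => // iT _; apply: (subsetP TF).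
  have [w [wuv wF]] : exists w, (w == u) || (w == v) /\ independent e (w |: F).
    by case/orP: ind; [exists u | exists v]; rewrite eqxx ?orbT.
  have [F1 F1m] := facet_exists wF; rewrite subUset sub1set => /andP[wF1 FF1].
  exists F1; split=> //; rewrite sumE ?(subset_trans TF) //.
  by case/orP: wuv => /eqP <-; rewrite wF1 ?addn0; case: (_ \in F1).
pose D F : k := (F == T)%:R.
pose phi F : k := if live e a F && independent e (u |: F) then codiff D F else 0.
have DN F : ~~ (T \subset F) -> D F = 0.
  by rewrite /D; case: eqP => // ->; rewrite subxx.
move=> /(_ phi)[F nlv|F lvF Fp|psi psiL psiE].
- by rewrite /phi (negPf nlv).
- have [uF|uF] := boolP (independent e (u |: F)).
    rewrite -[RHS](codiff_codiff D F); apply: codiff_eq => i iF; rewrite /phi.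
    rewrite (independentS _ uF) ?setUS ?subD1set // andbT.
    case: ifPn => // nlv; rewrite [RHS]big1 // => j jF; rewrite DN ?mulr0 //.
    apply: contra nlv => TF; rewrite liveE (subset_trans TF) ?subD1set //=.
    by rewrite (independentS _ uF) ?setUS ?subD1set.
  have vF : independent e (v |: F) by move: lvF; rewrite liveE (negPf uF) => /andP[].
  rewrite [LHS]big1 // => i iF; rewrite /phi liveE.
  case: ifP => [/andP[/andP[TFi _] uFi]|]; last by rewrite mulr0.
  (* A face on the [u] side has one element [w] outside [T], adjacent to neither [u] nor [v];
     maximality of [T] then gives an edge inside the independent set [F]. *)
  have cFi : #|F :\ i :\: T| = 1%N.
    have := cardsD1 i F; rewrite iF Fp add1n => -[Fi].
    by have := cardsDS TFi; rewrite -Fi subSn // subnn.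
  have /cards1P[w wE] : #|F :\ i :\: T| == 1%N by rewrite cFi.
  have : w \in F :\ i :\: T by rewrite wE inE.
  rewrite in_setD => /andP[wT wFi]; have wF : w \in F by move: wFi; rewrite inE => /andP[].
  have wu : ~~ e w u by move/independentP: uFi; apply; [apply: setU1r | apply: setU11].
  have wv : ~~ e w v by move/independentP: vF; apply; [apply: setU1r | apply: setU11].
  have [t tT] := Tmax w wT wu wv; apply: contraTeq => _.
  by move/independentP: vF; apply; apply: setU1r => //; apply: (subsetP (subset_trans TFi (subD1set _ _))).
have UU w F : w |: (w |: F) = w |: F by rewrite setUA setUid.
have TuF : live e a (u |: T) by rewrite liveE subsetUr UU uT.
have TvF : live e a (v |: T) by rewrite liveE subsetUr UU vT orbT.
have psi_at w : w \notin T -> codiff psi (w |: T) = face_sign k w (w |: T) * psi T.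
  move=> wT; rewrite /codiff (bigD1 w) ?setU11 //= setU1K // big1 ?addr0 // => i.
  rewrite !inE => /andP[/orP[/eqP->|iT] iw]; first by rewrite eqxx in iw.
  rewrite psiL ?mulr0 // liveE; apply: contraTN iT => /andP[/subsetP/(_ i) + _].
  by rewrite !inE eqxx => h; apply/negP => /h.
have card1 w : w \notin T -> #|w |: T| = #|T|.+1 by move=> wT; rewrite cardsU1 wT.
(* The value at [v |: T] forces [psi T = 0], while that at [u |: T] would force [psi T = 1]. *)
have := psiE _ TvF (card1 _ vNT); rewrite psi_at // /phi TvF ifN.
  move=> /esym/eqP; rewrite mulf_eq0 signr_eq0 /= => /eqP psi0.
  have := psiE _ TuF (card1 _ uNT); rewrite psi_at // psi0 mulr0 /phi TuF UU uT.
  rewrite /codiff (bigD1 u) ?setU11 //= setU1K // big1 => [|i]; last first.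
    rewrite !inE => /andP[/orP[/eqP->|iT] iw]; first by rewrite eqxx in iw.
    rewrite DN ?mulr0 //; apply: contraTN iT => /subsetP/(_ i).
    by rewrite !inE eqxx => h; apply/negP => /h.
  by rewrite /D eqxx mulr1 addr0 => /eqP; rewrite signr_eq0.
apply: contraL euv => /independentP; apply; by rewrite !inE ?eqxx ?orbT.
Qed.

End Necessity.

(** * Classification of the graphs *)

Section NecessaryGraphs.
Variables (n : nat) (e : rel 'I_n) (d : nat).
Hypotheses (e_sym : ssrbool.symmetric e) (e_irr : irreflexive e).
Hypothesis e_noisolated : forall i, exists j, e i j.
Hypothesis ind_le : forall F, independent e F -> (#|F| <= d)%N.
Hypothesis edge_le : forall u v (T : {set 'I_n}), e u v -> T != set0 ->
  independent e (u |: T) -> independent e (v |: T) ->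
  (forall i, i \notin T -> ~~ e i u -> ~~ e i v -> exists2 t, t \in T & e i t) ->
  (d <= #|T|.+1)%N.

Definition bipartition (X Y : {set 'I_n}) :=
  [/\ X :|: Y = setT, [disjoint X & Y], #|X| = d /\ #|Y| = d &
    forall i j, e i j -> (i \in X) && (j \in Y) || (i \in Y) && (j \in X)].

(** For ends on opposite sides of a bipartition: each end sees the whole opposite side. *)
Definition full_edge u v := [forall w, e w u || e w v].

Lemma bipartitionC X Y : bipartition X Y -> bipartition Y X.
Proof.
move=> [XY dXY [cX cY] eXY]; split=> //; first by rewrite setUC.
  by rewrite disjoint_sym.
by move=> i j /eXY; rewrite orbC.
Qed.

(** * Hall's condition and full edges *)

Section Bipartition.
Variables X Y : {set 'I_n}.
Hypothesis bXY : bipartition X Y.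

Lemma in_partY i : (i \in Y) = (i \notin X).
Proof.
have [/setP/(_ i) + dXY _ _] := bXY; rewrite !inE.
have [iX _|//] := boolP (i \in X).
by apply: contraTF iX => iY; rewrite (disjointFl dXY).
Qed.

Lemma edgeX i j : e i j -> (j \in X) = (i \notin X).
Proof. by have [_ _ _ eXY] := bXY => /eXY; rewrite !in_partY; case: (i \in X); case: (j \in X). Qed.

Lemma cardX : #|X| = d. Proof. by have [_ _ [-> _]] := bXY. Qed.

(** [S] together with [X :\: A] is independent, hence has at most [d = #|X|] elements. *)
Lemma hall_le (S A : {set 'I_n}) : S \subset Y -> A \subset X ->
  (forall y x, y \in S -> e y x -> x \in A) -> (#|S| <= #|A|)%N.
Proof.
move=> SY AX SA.
have SX y : y \in S -> y \notin X by move=> /(subsetP SY); rewrite in_partY.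
have dSX : [disjoint S & X :\: A].
  by apply/pred0P => y /=; apply/negP => /andP[/SX yX]; rewrite inE (negPf yX) andbF.
have /ind_le : independent e (S :|: (X :\: A)).
  apply/independentP => i j; rewrite !inE => /orP[iS|/andP[iA iX]] /orP[jS|/andP[jA jX]].
  - by apply: contraL (SX _ jS) => /edgeX ->; rewrite SX.
  - by apply: contra jA; apply: SA.
  - by rewrite e_sym; apply: contra iA; apply: SA.
  - by apply: contraL jX => /edgeX->; rewrite iX.
have := cardsID A X; rewrite cardX (setIidPr AX).
by rewrite cardsU (disjoint_setI0 dSX) cards0 subn0; have := subset_leq_card AX; rewrite cardX; lia.
Qed.

Definition nbr b := [set x | e x b].

Lemma nbr_sub b : b \in Y -> nbr b \subset X.
Proof. by move=> bY; apply/subsetP => x; rewrite inE => /edgeX h; move: bY; rewrite in_partY h negbK. Qed.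

Definition inner a b := [set y in Y | ~~ e y a & nbr y \subset nbr b].

(** The set [T] made of [X :\: nbr b] and [inner a b] is maximal among the independent sets of
    vertices adjacent to neither [a] nor [b], and nonempty as the edge is not full; [edge_le] bounds
    its size from below. *)
Lemma inner_card a b : b \in Y -> e a b -> ~~ full_edge a b -> (#|nbr b| <= #|inner a b|.+1)%N.
Proof.
move=> bY eab /forallPn[w]; rewrite negb_or => /andP[wa wb].
have aX : a \in X by have := edgeX eab; rewrite in_partY in bY; move: bY; case: (a \in X) => //= /negPf->.
pose T := (X :\: nbr b) :|: inner a b.
have iT i : i \notin T -> ~~ e i a -> ~~ e i b -> exists2 t, t \in T & e i t.
  rewrite !inE in_partY => + ia ib; rewrite ia ib /=.
  have [//|iX /= /subsetPn[t]] := boolP (i \in X).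
  rewrite inE => ti tb; exists t; last by rewrite e_sym.
  by rewrite inE in_setD tb (edgeX (i := i)) ?iX // e_sym.
have T0 : T != set0.
  have [wT|/iT/(_ wa wb)[t tT _]] := boolP (w \in T); apply/set0Pn; [by exists w | by exists t].
have Tind : independent e T.
  apply/independentP => i j; rewrite !inE !in_partY.
  move=> /orP[/andP[ib iX]|/and3P[iX ia /subsetP iN]] /orP[/andP[jb jX]|/and3P[jX ja /subsetP jN]].
  - by apply: contraL jX => /edgeX->; rewrite iX.
  - by apply: contra ib => eij; have := jN i; rewrite !inE; apply.
  - by apply: contra jb; rewrite e_sym => eij; have := iN j; rewrite !inE; apply.
  - by apply: contra jX => /edgeX->.
have := edge_le eab T0 _ _ iT.
have -> : independent e (a |: T).
  apply: independentU1 => // j; rewrite !inE in_partY => /orP[/andP[jb jX]|/and3P[_ ja _]].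
    by apply: contraL jX => /edgeX->; rewrite aX.
  by rewrite e_sym.
have -> : independent e (b |: T).
  apply: independentU1 => // j; rewrite !inE in_partY => /orP[/andP[jb jX]|/and3P[jX _ _]].
    by rewrite e_sym.
  by apply: contra jX => /edgeX->; rewrite -in_partY.
move=> /(_ isT isT) led.
have cT : #|T| = (#|X :\: nbr b| + #|inner a b| - #|(X :\: nbr b) :&: inner a b|)%N.
  exact: cardsU.
have := cardsDS (nbr_sub bY); rewrite cardX => cD.
have := subset_leq_card (nbr_sub bY); rewrite cardX.
move: led; rewrite cT cD; move: #|nbr b| #|inner a b| #|_ :&: _| => p q r; lia.
Qed.

(* If neither edge were full, the two sets of vertices nested under b would
   together violate Hall's condition. *)
Lemma two_edges_full a a' b : b \in Y -> e a b -> e a' b -> a != a' ->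
  full_edge a b || full_edge a' b.
Proof.
move=> bY ab a'b aa'; apply/negPn/negP; rewrite negb_or => /andP[nf nf'].
have := inner_card bY ab nf; have := inner_card bY a'b nf'.
set I1 := inner a b; set I2 := inner a' b => c1 c2.
have sub1 x : inner x b \subset Y by apply/subsetP => y; rewrite inE => /andP[].
have bI : b \notin I1 :|: I2 by rewrite !inE bY ![e b _]e_sym ab a'b.
(* With [r = #|nbr b|], both inner sets have at least [r - 1] elements. Hall bounds their union by
   [r - 1], as [b] lies in neither, and their intersection by [r - 2], as its elements see neither
   [a] nor [a']. Inclusion-exclusion gives a contradiction. *)
have cU : (#|b |: (I1 :|: I2)| <= #|nbr b|)%N.
  apply: hall_le (nbr_sub bY) _; first by rewrite subUset sub1set bY subUset !sub1.
  move=> y x; rewrite in_setU1 => /orP[/eqP->|]; first by rewrite inE e_sym.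
  by rewrite !inE => /orP[]/and3P[_ _ /subsetP h] yx; have := h x; rewrite !inE; apply; rewrite e_sym.
have cI : (#|I1 :&: I2| <= #|nbr b :\ a :\ a'|)%N.
  apply: hall_le.
  - exact: subset_trans (subsetIl _ _) (sub1 a).
  - by apply: subset_trans (nbr_sub bY); rewrite !subDset !subsetU ?subxx ?orbT.
  move=> y x; rewrite inE => /andP[]; rewrite !inE.
  move=> /and3P[_ ya /subsetP h] /and3P[_ ya' _] yx; have := h x; rewrite !inE e_sym yx => /(_ isT)->.
  by rewrite andbT; apply/andP; split; [apply: contraNneq ya' | apply: contraNneq ya] => <-.
have := cardsU I1 I2; have := subset_leq_card (subsetIl I1 I2).
move: cU; rewrite cardsU1 bI.
have := cardsD1 a (nbr b); have := cardsD1 a' (nbr b :\ a); rewrite !inE eq_sym aa' ab a'b /=.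
move: cI c1 c2; move: #|nbr b :\ a :\ a'| #|nbr b :\ a| #|nbr b| #|I1| #|I2|.
move: #|I1 :&: I2| #|I1 :|: I2| => p q r s t u v. lia.
Qed.

End Bipartition.

Lemma full_edgeX X Y u v w : bipartition X Y -> full_edge u v -> v \in Y -> u \in X ->
  w \in X -> e w v.
Proof.
move=> bXY /forallP/(_ w) + vY uX wX => /orP[|//] /(edgeX bXY).
by rewrite wX uX.
Qed.

Lemma full_edgeC u v : full_edge u v = full_edge v u.
Proof. by apply: eq_forallb => w; rewrite orbC. Qed.

Lemma complete_graph_iso X Y : bipartition X Y ->
  (forall x y, x \in X -> y \in Y -> e x y) -> graph_iso e (@complete_bipartite d d).
Proof.
move=> bXY full; have [XY dXY [cX cY] _] := bXY.
pose g (u : 'I_d + 'I_d) : 'I_n := match u with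
  | inl i => enum_val (cast_ord (esym cX) i) | inr i => enum_val (cast_ord (esym cY) i) end.
have gX i : g (inl i) \in X by apply: enum_valP.
have gY i : g (inr i) \in Y by apply: enum_valP.
have g_inj : injective g.
  move=> [i|i] [j|j] gij.
  - by congr inl; apply: cast_ord_inj (enum_val_inj gij).
  - by have := gX i; rewrite gij => /(disjointFr dXY); rewrite gY.
  - by have := gX j; rewrite -gij => /(disjointFr dXY); rewrite gY.
  - by congr inr; apply: cast_ord_inj (enum_val_inj gij).
have [f fK gK] : bijective g.
  apply: inj_card_bij => //; rewrite card_sum !card_ord.
  by rewrite -[n]card_ord -cardsT -XY cardsU (disjoint_setI0 dXY) cards0 cX cY subn0.
exists f; split; first by exists g.
move=> i j; rewrite -[in RHS](gK i) -[in RHS](gK j).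
have nX u v : u \in X -> v \in X -> e u v = false.
  by move=> uX vX; apply/negP => /(edgeX bXY); rewrite uX vX.
have nY u v : u \in Y -> v \in Y -> e u v = false.
  rewrite !(in_partY bXY) => uX vX; apply/negP => /(edgeX bXY).
  by rewrite (negPf uX) (negPf vX).
case: (f i) (f j) => [u|u] [v|v].
- by rewrite nX ?gX.
- by rewrite full ?gX ?gY.
- by rewrite e_sym full ?gX ?gY.
- by rewrite nY ?gY.
Qed.

Lemma path_graph_iso (g : 4.-tuple 'I_n) : n = 4%N -> uniq g ->
  (forall i j : 'I_4, e (tnth g i) (tnth g j) = path_graph i j) ->
  graph_iso e (@path_graph 3).
Proof.
move=> n4 /tuple_uniqP g_inj ge.
have [f fK gK] : bijective (tnth g) by apply: inj_card_bij => //; rewrite !card_ord n4.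
exists f; split; first by exists (tnth g).
by move=> i j; rewrite -ge !gK.
Qed.

Lemma card_partition X Y : bipartition X Y -> n = (d + d)%N.
Proof.
move=> [XY dXY [cX cY] _]; rewrite -[LHS]card_ord -cardsT -XY cardsU (disjoint_setI0 dXY).
by rewrite cards0 cX cY subn0.
Qed.

(** Two neighbours of a vertex in [Y] make it see all of [X]. Given a nonedge [a0 y], every other
    vertex of [X] sees all of [Y]; two such vertices would make [y] see [a0], so there is just one,
    [a1], and the graph is the path [a0 b a1 y]. *)
Lemma nonmatching_graph X Y b a a' : bipartition X Y -> b \in Y -> e a b -> e a' b -> a != a' ->
  graph_iso e (@complete_bipartite d d) \/ graph_iso e (@path_graph 3).
Proof.
move=> bXY bY ab a'b aa'; have bYX := bipartitionC bXY.
have inX u v : v \in Y -> e u v -> u \in X.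
  by move=> vY /(edgeX bYX); rewrite vY -(in_partY bYX) => <-.
have all_or u v y : y \in Y -> e u y -> e v y -> u != v -> forall x, x \in X -> e x y.
  move=> yY uy vy uv x xX; have uX := inX _ _ yY uy; have vX := inX _ _ yY vy.
  have /orP[f|f] := two_edges_full bXY yY uy vy uv.
    exact: full_edgeX bXY f yY uX xX.
  exact: full_edgeX bXY f yY vX xX.
have allb := all_or _ _ _ bY ab a'b aa'.
have [full|] := boolP [forall x in X, forall y in Y, e x y].
  left; apply: (complete_graph_iso bXY) => x y xX yY.
  by have /forall_inP/(_ y yY) := forall_inP full x xX.
move=> /forall_inPn[a0 a0X /forall_inPn[y yY na0y]]; right.
have full x : x \in X -> x != a0 -> forall y', y' \in Y -> e x y'.
  move=> xX xa0 y' y'Y; have a0x : a0 != x by rewrite eq_sym.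
  (* If the edge [a0 b] were full, [a0] would see [y]; hence [x b] is full. *)
  have /orP[] := two_edges_full bXY bY (allb _ a0X) (allb _ xX) a0x; rewrite full_edgeC => f.
    by case/negP: na0y; rewrite e_sym; apply: full_edgeX bYX f a0X bY yY.
  by rewrite e_sym; apply: full_edgeX bYX f xX bY y'Y.
have cXa0 : (#|X :\ a0| <= 1)%N.
  rewrite leqNgt; apply/negP => /card_gt1P[u [v []]]; rewrite !inE.
  move=> /andP[ua0 uX] /andP[va0 vX] uv; case/negP: na0y.
  exact: all_or yY (full u uX ua0 y yY) (full v vX va0 y yY) uv a0 a0X.
have [a1 a1X a10] : exists2 a1, a1 \in X & a1 != a0.
  have [aX a'X] := (inX _ _ bY ab, inX _ _ bY a'b).
  by have [aa0|] := eqVneq a a0; [exists a' => //; rewrite -aa0 eq_sym | exists a].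
have d2 : d = 2%N.
  rewrite -(cardX bXY) (cardsD1 a0) a0X; apply/eqP; rewrite eqSS eqn_leq cXa0 card_gt0.
  by apply/set0Pn; exists a1; rewrite !inE a10.
have yb : y != b by apply: contraNneq na0y => ->; apply: allb.
have XY u v : u \in X -> v \in Y -> u != v.
  by rewrite (in_partY bXY) => uX; apply: contraNneq => <-.
have nX u v : u \in X -> v \in X -> e u v = false.
  by move=> uX vX; apply/negP => /(edgeX bXY); rewrite uX vX.
have nY u v : u \in Y -> v \in Y -> e u v = false.
  by move=> uY vY; apply/negP => /(edgeX bYX); rewrite uY vY.
apply: (@path_graph_iso [tuple a0; b; a1; y]).
- by rewrite (card_partition bXY) d2.
- rewrite /= !inE !negb_or [a0 == a1]eq_sym a10 [b == y]eq_sym yb [b == a1]eq_sym.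
  by rewrite !XY.
have E1 : e a0 b by apply: allb.
have E2 : e a1 b by apply: allb.
have E3 : e a1 y by apply: full.
have E4 : e a0 y = false by apply: negbTE.
have ee := (E1, E2, E3, E4, etrans (e_sym b a0) E1, etrans (e_sym b a1) E2,
  etrans (e_sym y a1) E3, etrans (e_sym y a0) E4, nX _ _ a0X a1X, nX _ _ a1X a0X,
  nY _ _ bY yY, nY _ _ yY bY, e_irr).
by move=> [[|[|[|[|//]]]] ?] [[|[|[|[|//]]]] ?]; rewrite !(tnth_nth a0) /= ee.
Qed.

Lemma graph_classification X Y : bipartition X Y ->
  [\/ exists2 m : nat, (2 <= m)%N & graph_iso e (@complete_bipartite m m),
      graph_iso e (@path_graph 3)
    | forall i : 'I_n, degree e i = 1%N].
Proof.
move=> bXY.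
have [deg1|] := boolP [forall i, degree e i == 1%N].
  by constructor 3 => i; apply/eqP/(forallP deg1).
move=> /forallPn[b degb].
have [a [a' [ab a'b aa']]] : exists a a', [/\ e a b, e a' b & a != a'].
  have : (1 < degree e b)%N.
    have [c bc] := e_noisolated b.
    by move: degb; rewrite /degree (cardsD1 c) inE bc; case: #|_|.
  move=> /card_gt1P[a [a' [+ + aa']]]; rewrite !inE ![e b _]e_sym => ab a'b.
  by exists a, a'.
have nbrs Z W : bipartition Z W -> b \in W -> (2 <= d)%N.
  move=> bZW bW; rewrite -(cardX bZW); apply/card_gt1P; exists a, a'; split=> //.
    by have := edgeX (bipartitionC bZW) ab; rewrite bW -(in_partY (bipartitionC bZW)) => <-.
  by have := edgeX (bipartitionC bZW) a'b; rewrite bW -(in_partY (bipartitionC bZW)) => <-.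
have main Z W : bipartition Z W -> b \in W -> 
  [\/ exists2 m : nat, (2 <= m)%N & graph_iso e (@complete_bipartite m m),
      graph_iso e (@path_graph 3) | forall i : 'I_n, degree e i = 1%N].
  move=> bZW bW; have [iso|iso] := nonmatching_graph bZW bW ab a'b aa'; last by constructor 2.
  by constructor 1; exists d => //; apply: nbrs bZW bW.
have [bX|] := boolP (b \in X); first exact: main (bipartitionC bXY) bX.
by rewrite -(in_partY bXY) => bY; apply: main bXY bY.
Qed.


End NecessaryGraphs.

(** * Acyclic strands *)

Section Sufficiency.
Variables (k : fieldType) (n : nat) (e : rel 'I_n).
Hypotheses (e_sym : ssrbool.symmetric e) (e_irr : irreflexive e).
Implicit Types (F T X : {set 'I_n}) (a : {ffun 'I_n -> int}).
Local Notation M := (quotmod (symbolic_square k e)).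
Local Notation x := (fun i : 'I_n => 'X_i : {mpoly k[n]}).

(** Every [F'] witnessing liveness contains [i], as [a i] alone exceeds the allowed weight. *)
Lemma live_acyclic_ge2 a i p : (forall j, 0 <= a j) -> 1 < a i -> strand_acyclic k (live e a) p.
Proof.
move=> a0 ai; apply: (@strand_acyclic_cone _ _ _ i) => F /liveP[neg [F' [F'm FF' le1]]].
have iF' : i \in F'.
  apply: contraLR ai => iF'; rewrite -Order.TotalTheory.leNgt.
  apply: Order.POrderTheory.le_trans le1; rewrite (bigD1 i) //= Num.Theory.lerDl.
  by apply: Num.Theory.sumr_ge0 => j _; apply: a0.
have nneg j : a j < 0 = false by rewrite Order.TotalTheory.ltNge a0.
split; apply/liveP; split=> [j|]; rewrite ?nneg //; exists F'; split=> //.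
  by rewrite subUset sub1set iF'.
by apply: subset_trans FF'; apply: subD1set.
Qed.

Lemma gcm_strands :
  (forall a i p F, a i < 0 -> facet e F -> (p < #|F|)%N -> strand_acyclic k (live e a) p) ->
  generalized_CM x M.
Proof.
move=> ac p /facet_lt_dim[F Fm pF].
(* The exceptional degrees are the 0-1 vectors: any other has a negative entry or an entry at least
   2. *)
pose A := [seq [ffun i => (nat_of_bool (f i))%:Z] | f : {ffun 'I_n -> bool} <- enum {: {ffun 'I_n -> bool}}].
apply: (@finite_length_strands _ _ _ _ A) => a aA.
have [/existsP[i ai]|/existsPn a0] := boolP [exists i, a i < 0]; first exact: ac ai Fm pF.
have {}a0 i : 0 <= a i by rewrite Order.TotalTheory.leNgt.
have [/existsP[i ai]|/existsPn a1] := boolP [exists i, 1 < a i]; first exact: live_acyclic_ge2 ai.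
case/negP: aA; apply/mapP; exists [ffun i => a i != 0]; first by rewrite mem_enum.
apply/ffunP => i; rewrite !ffunE; have := a0 i; have := a1 i.
by case: (a i) => [[|[|m]]|m].
Qed.

(** Live sets contain [i], so [X] is their only witness. Either all entries on [X] are negative and
    only [X], of degree above [p], can be live, or a vertex of [X] with nonnegative entry is a cone
    apex. *)
Lemma acyclic_unique_facet a i p X : a i < 0 -> i \in X -> facet e X -> (p < #|X|)%N ->
  (forall F, facet e F -> i \in F -> F = X) -> strand_acyclic k (live e a) p.
Proof.
move=> ai iX Xm pX uniX.
have liveX F : live e a F -> [/\ forall j, a j < 0 -> j \in F, F \subset X &
    \sum_(j | j \notin X) a j <= 1].
  move=> /liveP[neg [F' [F'm FF' le1]]].
  by rewrite -(uniX F') // (subsetP FF') // neg.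
have [XG|/forallPn[v]] := boolP [forall j in X, a j < 0].
  move=> phi phiL _; exists (fun=> 0) => // F /liveX[neg FX _] Fp.
  have XF : X \subset F by apply/subsetP => j jX; apply: neg; apply: (forall_inP XG).
  by move: pX; rewrite ltnNge -Fp subset_leq_card.
rewrite negb_imply => /andP[vX av]; apply: (@strand_acyclic_cone _ _ _ v) => F /liveX[neg FX le1].
split; apply/liveP; split=> [j aj|].
- by rewrite !inE neg // orbT.
- by exists X; split=> //; rewrite subUset sub1set vX.
- by rewrite !inE neg // andbT; apply: contraNneq av => <-.
by exists X; split=> //; apply: subset_trans FX; apply: subD1set.
Qed.

(** Transitivity of nonadjacency makes the maximal independent sets a partition of the vertices, so
    each vertex lies in exactly one. *)
Lemma gcm_complete : (forall i j l, ~~ e i j -> ~~ e j l -> ~~ e i l) ->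
  (forall F T, facet e F -> facet e T -> #|F| = #|T|) -> generalized_CM x M.
Proof.
move=> tr cF; apply: gcm_strands => a i p F ai Fm pF.
have /facet_exists[X Xm] : independent e [set i].
  by apply/(independentP e) => u v; rewrite !inE => /eqP-> /eqP->; rewrite e_irr.
rewrite sub1set => iX; apply: (acyclic_unique_facet ai iX Xm); first by rewrite (cF X F).
move=> T Tm iT; apply/eqP; rewrite eqEsubset; apply/andP.
have sub F1 F2 : facet e F1 -> facet e F2 -> i \in F1 -> i \in F2 -> F1 \subset F2.
  move=> F1m F2m i1 i2; apply/subsetP => v v1; apply/negPn/negP.
  have [F1ind _] := facetP e_sym e_irr F1 F1m.
  have [F2ind F2max] := facetP e_sym e_irr F2 F2m.
  move=> /F2max[u u2]; apply/negP; apply: (tr _ i).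
    by move/independentP: F1ind; apply.
  by move/independentP: F2ind; apply.
by split; apply: sub.
Qed.

(** Live sets contain [i], so degree 0 is empty and degree 1 has at most [[set i]]. If that set is
    live, so is a witness [F'] of size 2, where the cocycle condition forces [phi] to vanish. *)
Lemma gcm_facets2 : (forall F, facet e F -> #|F| = 2%N) -> generalized_CM x M.
Proof.
move=> c2; apply: gcm_strands => a i p F ai Fm; rewrite c2 // => p2 {F Fm}.
have liveN F : i \notin F -> ~~ live e a F.
  by move=> iF; apply/negP => /liveP[/(_ i ai) + _]; apply/negP.
move=> phi phiL dphi; exists (fun=> 0) => // F lv Fp.
have codiff0 : codiff (fun=> 0 : k) F = 0 by rewrite /codiff big1 // => j _; rewrite mulr0.
rewrite codiff0; have iF : i \in F by apply: contraLR lv; apply: liveN.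
have {}p2 : p = 1%N by move: p2; rewrite -Fp (cardsD1 i) iF; case: #|_|.
have /liveP[neg [F' [F'm FF' le1]]] := lv.
have FE : F = [set i].
  by apply/eqP; rewrite eq_sym eqEcard sub1set iF cards1 Fp p2.
have := cardsD1 i F'; rewrite c2 // (subsetP FF') // => -[/esym/eqP/cards1P[w wE]].
have : w \in F' :\ i by rewrite wE inE.
rewrite !inE => /andP[wi wF'].
have F'E : F' = w |: F by rewrite FE setUC -wE setD1K // (subsetP FF').
have lvF' : live e a F'.
  by apply/liveP; split=> [j aj|]; [apply: (subsetP FF'); apply: neg | exists F'].
have wF : w \notin F by rewrite FE inE.
have := dphi F' lvF'; rewrite c2 // p2 => /(_ erefl).
rewrite F'E /codiff (bigD1 w) ?setU11 //= setU1K // big1 => [/eqP|j].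
  by rewrite addr0 mulf_eq0 signr_eq0 => /eqP.
rewrite FE !inE => /andP[/orP[/eqP->|/eqP->]]; first by rewrite eqxx.
by move=> _; rewrite phiL ?mulr0 // liveN // !inE eqxx.
Qed.

(** * Perfect matchings, with [s] exchanging the ends of each edge *)

Section PerfectMatching.
Variable s : 'I_n -> 'I_n.
Hypothesis sP : forall i j, e i j = (j == s i).

Lemma matchK : involutive s.
Proof. by move=> i; apply/esym/eqP; rewrite -sP e_sym sP. Qed.

Lemma match_neq i : s i != i.
Proof. by rewrite eq_sym -sP e_irr. Qed.

Lemma matching_facetP F : reflect (forall i, (s i \in F) = (i \notin F)) (facet e F).
Proof.
apply: (iffP (facetP e_sym e_irr F)) => [[/independentP Find Fmax] i|h].
  have [iF|iF] := boolP (i \in F).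
    by apply/negP => sF; have := Find i (s i) iF sF; rewrite sP eqxx.
  by have [u uF] := Fmax i iF; rewrite sP => /eqP <-.
split=> [|v vF]; last by exists (s v); rewrite ?h // sP.
apply/independentP => i j iF jF; rewrite sP; apply: contraL jF => /eqP ->.
by rewrite h negbK.
Qed.

Lemma matching_facet_card F : facet e F -> (#|F| + #|F| = n)%N.
Proof.
move=> /matching_facetP h.
have -> : (#|F| + #|F| = #|F| + #|s @: F|)%N by rewrite card_imset //; apply: inv_inj matchK.
have -> : s @: F = ~: F.
  apply/setP => i; rewrite inE -h; apply/imsetP/idP => [[j jF ->]|iF]; first by rewrite matchK.
  by exists (s i); rewrite ?matchK.
by rewrite cardsC card_ord.
Qed.

Lemma matching_swap F v : facet e F -> s v \in F -> facet e (v |: (F :\ s v)).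
Proof.
move=> /matching_facetP h svF; have vF : v \notin F by rewrite -h.
apply/matching_facetP => i; rewrite !inE.
have -> : (s i == s v) = (i == v) by rewrite (inj_eq (inv_inj matchK)).
have -> : (s i == v) = (i == s v) by rewrite -{1}(matchK v) (inj_eq (inv_inj matchK)).
rewrite h; have [->|iv] := eqVneq i v; first by rewrite eq_sym (negPf (match_neq v)).
by have [->|isv] := eqVneq i (s v).
Qed.

Lemma strand_acyclic_eq (L1 L2 : pred {set 'I_n}) p :
  L1 =1 L2 -> strand_acyclic k L1 p -> strand_acyclic k L2 p.
Proof. by move=> /funext->. Qed.

(* Induction on the edges not met by G: if v is the cheaper end of such an edge,
   the faces avoiding the other end form a cone with apex v. *)
Lemma matching_acyclic a (G : {set 'I_n}) p : (p + p < n)%N ->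
  (forall i, a i < 0 -> i \in G) ->
  strand_acyclic k [pred F | live e a F & G \subset F] p.
Proof.
move=> pn; have [m] := ubnP #|[set v | (v \notin G) && (s v \notin G)]|.
elim: m G => // m IH G ltm neg.
(* If [G] meets every edge, sets containing [G] have at least [n / 2] elements, so degree [p] is
   empty. *)
have [all|] := boolP [forall v, (v \in G) || (s v \in G)].
  move=> phi phiL _; exists (fun=> 0) => // F /andP[lv GF] Fp.
  have : (n <= #|F| + #|F|)%N.
    rewrite -[n in (n <= _)%N]card_ord -cardsT.
    have <- : F :|: s @: F = setT.
      apply/setP => v; rewrite !inE; have /orP[vG|svG] := forallP all v.
        by rewrite (subsetP GF).
      by apply/orP; right; apply/imsetP; exists (s v); rewrite ?matchK // (subsetP GF).
    by rewrite cardsU; apply: leq_trans (leq_subr _ _) _; rewrite leq_add2l leq_imset_card.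
  by rewrite Fp leqNgt pn.
have wlog_v v : v \notin G -> s v \notin G -> a (s v) <= a v ->
    strand_acyclic k [pred F | live e a F & G \subset F] p.
  move=> vG svG le; apply: (@strand_acyclic_split _ _ _ (s v)).
  - move=> A B C AB BC /andP[/= /liveP[negA _] GA] /andP[/= lvC GC].
    rewrite (subset_trans GA AB) andbT; apply: live_subset lvC BC _ => i ai.
    by apply: (subsetP AB); apply: negA.
  - apply: (@strand_acyclic_cone _ _ _ v) => F /= /andP[/andP[lv GF] svF].
    rewrite !inE (negPf svF) (negPf (match_neq v)) andbF (subset_trans GF) ?subsetUr //=.
    rewrite subsetD1 GF vG /= !andbT; split; last first.
      by apply: live_subset lv (subD1set _ _) _ => i ai; rewrite !inE (subsetP GF) ?neg // andbT; apply: contraNneq vG => <-; apply: neg.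
    have /liveP[negF [F' [F'm FF' le1]]] := lv.
    apply/liveP; split=> [i ai|]; first by rewrite !inE negF ?orbT.
    have [vF'|vF'] := boolP (v \in F').
      by exists F'; split=> //; rewrite subUset sub1set vF'.
    have svF' : s v \in F' by rewrite (matching_facetP _ F'm).
    (* Exchanging [s v] for [v] changes the weight outside by [a (s v) - a v], which is at most
       0. *)
    exists (v |: (F' :\ s v)); split; first exact: matching_swap.
      by rewrite setUS // subsetD1 FF' svF.
    apply: Order.POrderTheory.le_trans le1.
    rewrite (bigD1 (s v)) /=; last by rewrite !inE eqxx (negPf (match_neq v)).
    rewrite [leRHS](bigD1 v) //=.
    rewrite (eq_bigl (fun j => (j \notin F') && (j != v))) => [|j].
      by rewrite Num.Theory.lerD2r.
    rewrite !inE; have [->|jv] := eqVneq j v; first by rewrite andbF.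
    by have [->|jsv] := eqVneq j (s v); rewrite ?svF' ?andbT.
  (* Sets containing [s v] are handled by adding [s v] to [G], which then meets one more edge. *)
  apply: (@strand_acyclic_eq [pred F | live e a F & (s v |: G) \subset F]).
    by move=> F /=; rewrite subUset sub1set andbA andbAC.
  apply: IH => [|i ai]; last by rewrite !inE neg ?orbT.
  apply: leq_trans (ltm : (_ <= m)%N); apply: proper_card; apply/properP; split.
    by apply/subsetP => u; rewrite !inE !negb_or => /andP[/andP[_ ->] /andP[_ ->]].
  by exists v; rewrite !inE ?vG ?svG // eqxx andbF.
rewrite negb_forall => /existsP[v]; rewrite negb_or => /andP[vG svG].
have [le|lt] := Order.TotalTheory.leP (a (s v)) (a v); first exact: wlog_v le.
by apply: (wlog_v (s v)); rewrite ?matchK // Order.POrderTheory.ltW.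
Qed.

Lemma gcm_matching : generalized_CM x M.
Proof.
apply: gcm_strands => a i p F ai Fm pF.
apply: (@strand_acyclic_eq [pred F | live e a F & [set i | a i < 0] \subset F]).
  move=> F' /=; apply: andb_idr => /liveP[neg _].
  by apply/subsetP => j; rewrite inE; apply: neg.
apply: matching_acyclic => [|j]; last by rewrite inE.
by rewrite -(matching_facet_card Fm); lia.
Qed.

End PerfectMatching.
End Sufficiency.

(** * Generalized Cohen-Macaulayness of the symbolic square *)

(** Adjacency means lying on different sides, so a maximal independent set, being nonempty, is the
    whole side of any of its elements. *)
Lemma complete_facet_card (n m : nat) (e : rel 'I_n) (F : {set 'I_n}) : (0 < n)%N ->
  ssrbool.symmetric e -> irreflexive e -> graph_iso e (@complete_bipartite m m) ->
  facet e F -> #|F| = m.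
Proof.
move=> n_gt0 e_sym e_irr [f [f_bij fE]] /(facetP e_sym e_irr)[/independentP Find Fmax].
have [i iF] : exists i, i \in F.
  have [iF|/Fmax[u uF _]] := boolP (Ordinal n_gt0 \in F); [by exists (Ordinal n_gt0) | by exists u].
pose side (u : 'I_m + 'I_m) := if u is inl _ then true else false.
have eE u v : e u v = (side (f u) != side (f v)).
  by rewrite -fE; case: (f u) (f v) => [?|?] [?|?].
have -> : F = f @^-1: [set u | side u == side (f i)].
  apply/setP => j; rewrite !inE; apply/idP/idP => [jF|ji].
    by have := Find j i jF iF; rewrite eE negbK.
  apply/negPn/negP => /Fmax[u uF]; rewrite eE (eqP ji) => ne.
  by have := Find i u iF uF; rewrite eE ne.
rewrite on_card_preimset; last exact: onW_bij.
have inj_inl : injective (@inl 'I_m 'I_m) by move=> u v [].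
have inj_inr : injective (@inr 'I_m 'I_m) by move=> u v [].
case: (f i) => _ /=.
  rewrite -[RHS]card_ord -cardsT -(card_imset _ inj_inl); apply: eq_card => u.
  rewrite !inE; apply/idP/imsetP => [|[v _ ->] //].
  by case: u => // u _; exists u.
rewrite -[RHS]card_ord -cardsT -(card_imset _ inj_inr); apply: eq_card => u.
rewrite !inE; apply/idP/imsetP => [|[v _ ->] //].
by case: u => // u _; exists u.
Qed.

Lemma path_facet_card (n : nat) (e : rel 'I_n) (F : {set 'I_n}) :
  ssrbool.symmetric e -> irreflexive e -> graph_iso e (@path_graph 3) ->
  facet e F -> #|F| = 2%N.
Proof.
move=> e_sym e_irr [f [[g fK gK] fE]] /(facetP e_sym e_irr)[/independentP Find Fmax].
(* Membership in [F] at position [m] of the path. Independence and maximality become conditions on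
   four booleans, checked on all sixteen patterns. *)
pose c m := g (inord m) \in F.
have cE i : (i \in F) = c (f i) by rewrite /c inord_val fK.
have adj (i j : nat) : (i < 4)%N -> (j < 4)%N ->
    e (g (inord i)) (g (inord j)) = (i.+1 == j) || (j.+1 == i).
  by move=> i4 j4; rewrite -fE !gK /path_graph !inordK.
have c_adj i : (i.+1 < 4)%N -> c i -> c i.+1 = false.
  move=> i4 ci; apply/negP => cj; have := Find _ _ ci cj.
  by rewrite adj ?eqxx // ltnW.
have c_max i : (i < 4)%N -> c i || (i < 3)%N && c i.+1 || (0 < i)%N && c i.-1.
  move=> i4; have [//|/Fmax[u]] := boolP (c i); rewrite cE => cu.
  have := adj i (f u) i4 (ltn_ord _); rewrite inord_val fK => ->.
  case/boolP: (i.+1 == f u) => [/eqP iu _|_ /= /eqP ui].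
    by rewrite iu cu andbT -ltnS ltn_ord.
  by rewrite -ui /= cu orbT.
have -> : #|F| = (c 0%N + c 1%N + c 2%N + c 3%N)%N.
  rewrite -sum1_card big_mkcond (reindex g) /=; last by exists f => i _.
  transitivity (\sum_(i < 4) c i)%N; last by rewrite !big_ord_recr big_ord0.
  by apply: eq_bigr => i _; rewrite cE gK; case: (c i).
have := (c_adj 0%N isT, c_adj 1%N isT, c_adj 2%N isT).
have := (c_max 0%N isT, c_max 1%N isT, c_max 2%N isT, c_max 3%N isT).
move=> [[[m0 m1] m2] m3] [[a0 a1] a2]; move: m0 m1 m2 m3 a0 a1 a2 => /=.
by case: (c 0%N) (c 1%N) (c 2%N) (c 3%N) => [] [] [] [] //= _ _ _ _ a0 a1 a2;
  first [by have := a0 isT | by have := a1 isT | by have := a2 isT].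
Qed.

Theorem proposition4p4 (k : fieldType) (n : nat) (e : rel 'I_n)
  (n_gt0 : (0 < n)%N)
  (e_sym : ssrbool.symmetric e) (e_irr : irreflexive e)
  (e_bip : bipartite e)
  (e_noisolated : forall i : 'I_n, exists j : 'I_n, e i j) :
  generalized_CM (fun i : 'I_n => 'X_i : {mpoly k[n]})
    (quotmod (symbolic_square k e))
  <->
  [\/ exists2 m : nat, (2 <= m)%N & graph_iso e (@complete_bipartite m m),
      graph_iso e (@path_graph 3)
    | forall i : 'I_n, degree e i = 1%N].
Proof.
split=> [gcm|].
  have not_fin p F : facet e F -> (p < #|F|)%N ->
      ~ finite_length (local_cohomology (fun i : 'I_n => 'X_i : {mpoly k[n]})
          (quotmod (symbolic_square k e)) p) -> False.
    by move=> Fm pF; apply; apply: gcm; apply: lt_dim_facet Fm pF.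
  (* Unmixedness: a smaller [T] would give classes of unbounded pole order in degree [#|T|], below
     the dimension. Since [n > 0], [T] is nonempty and has room for a pole. *)
  have facet_le F T : facet e F -> facet e T -> (#|F| <= #|T|)%N.
    move=> Fm Tm; rewrite leqNgt; apply/negP => lt; apply: not_fin Fm lt _.
    have [v vT] : exists v, v \in T.
      have [_ Tmax] := facetP e_sym e_irr T Tm.
      by have [vT|/Tmax[u uT _]] := boolP (Ordinal n_gt0 \in T);
        [exists (Ordinal n_gt0) | exists u].
    apply: (@infinite_length_poles _ _ _ _ v
      (fun j => [ffun i => if i \in T then - j.+1%:Z else 0])) => j.
      by rewrite ffunE vT.
    exact: facet_strand.
  (* Without isolated vertices each side is a maximal independent set, so both sides have the same
     size, which serves as [d]. *)
  have facet_part X Y : X :|: Y = setT -> [disjoint X & Y] ->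
      (forall i j, e i j -> (i \in X) && (j \in Y) || (i \in Y) && (j \in X)) -> facet e X.
    move=> XY dXY eXY; apply/(facetP e_sym e_irr); split=> [|v vX].
      apply/independentP => i j iX jX; apply/negP => /eXY.
      by rewrite iX jX !(disjointFr dXY).
    have [j evj] := e_noisolated v; exists j => //.
    by have := eXY v j evj; rewrite (negPf vX) /= => /andP[].
  have [X [Y [XY dXY eXY]]] := e_bip.
  have Xm := facet_part X Y XY dXY eXY.
  have Ym : facet e Y.
    by apply: (facet_part Y X); rewrite ?(setUC Y) 1?disjoint_sym // => i j /eXY; rewrite orbC.
  apply: (graph_classification (d := #|X|) e_sym e_irr e_noisolated _ _ (X := X) (Y := Y)).
  - move=> F /facet_exists[T Tm FT]; apply: leq_trans (subset_leq_card FT) _.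
    exact: facet_le.
  - move=> u v T euv /set0Pn[t tT] uT vT Tmax; rewrite leqNgt; apply/negP => lt.
    apply: not_fin Xm lt _.
    apply: (@infinite_length_poles _ _ _ _ t (fun j => [ffun i =>
      if i \in T then - j.+1%:Z else ((i == u) + (i == v))%N%:Z])) => j.
      by rewrite ffunE tT.
    exact: edge_strand.
  by split=> //; split=> //; apply/eqP; rewrite eqn_leq !facet_le.
case=> [[m _ iso]|iso|deg1].
(* Nonadjacency in [K_{m,m}] means lying on the same side, hence is transitive. *)
- apply: gcm_complete => // [i j l|F T Fm Tm]; last by rewrite !(complete_facet_card n_gt0 e_sym e_irr iso).
  by have [f [_ fE]] := iso; rewrite -!fE; case: (f i) (f j) (f l) => [?|?] [?|?] [?|?].
- by apply: gcm_facets2 => // F; apply: path_facet_card.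
(* Degree 1 gives every vertex a unique partner [s i]. *)
have /choice[s sP] i : exists j, forall l, e i l = (l == j).
  have /eqP/cards1P[j jE] := deg1 i; exists j => l.
  by have /setP/(_ l) := jE; rewrite !inE.
exact: gcm_matching.
Qed.
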